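(* Let $\omega(n)=\sqrt{n^2+n^4}$ (the dispersion relation of the Boussinesq equation) and let $g\in BV(\mathbb T)\setminus H^{\frac12+}(\mathbb T)$, $\mathbb T=\mathbb R/(2\pi\mathbb Z)$. Then for a.e. $t$, $D_t(\omega,g)=\frac32$.
   Context: $BV(\mathbb T)$ is the set of functions of bounded variation; $H^{\frac12+}=\bigcup_{s>1/2}H^s$. $e^{itL_\omega}g(x)=\sum_{n\in\mathbb Z}\widehat g(n)e^{it\omega(n)+inx}$, and $D_t(\omega,g)$ is the maximum of the fractal dimensions of the graphs of the real and imaginary parts of $e^{itL_\omega}g$ as functions of $x$ (continuous representatives). The fractal (upper box-counting) dimension of a bounded set $E$ is $\limsup_{\epsilon\to0}\frac{\log\mathcal N(E,\epsilon)}{\log(1/\epsilon)}$, with $\mathcal N(E,\epsilon)$ the minimum number of $\epsilon$-balls needed to cover $E$. *)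

(* Defs.v *)
From HB Require Import structures.
From mathcomp Require Import all_boot all_order all_algebra.
From mathcomp Require Import all_classical all_reals all_analysis.
From mathcomp Require Import complex.

Set Implicit Arguments.
Unset Strict Implicit.
Unset Printing Implicit Defensive.

Import Order.TTheory GRing.Theory Num.Theory.
Import numFieldNormedType.Exports.

Local Open Scope classical_set_scope.
Local Open Scope ring_scope.
Local Open Scope complex_scope.

(** A function on the torus [T = R/(2 pi Z)] is a function [R -> R[i]] of
    period [2 pi]; [`[0, 2 pi]] represents one period. *)

Section Torus.
Variable R : realType.
Implicit Types (f g u : R -> R[i]) (omega : int -> R) (t x s : R).

Definition torus_fun f := periodic f (pi *+ 2).

(** For a periodic function, the total variation on the closed interval
    [`[0, 2 pi]] is the total variation on the circle. *)
Definition BV_torus g :=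
  [/\ torus_fun g,
      bounded_variation 0 (pi *+ 2) (fun x => complex.Re (g x)) &
      bounded_variation 0 (pi *+ 2) (fun x => complex.Im (g x))].

(** [exp(i x)] for real [x]. *)
Definition cexp x : R[i] := cos x +i* sin x.

Definition cintegral f : R[i] :=
  (\int[lebesgue_measure]_(x in `[0, pi *+ 2]) complex.Re (f x))%R +i*
  (\int[lebesgue_measure]_(x in `[0, pi *+ 2]) complex.Im (f x))%R.

Definition fourier g (n : int) : R[i] :=
  ((pi *+ 2)^-1)%:C * cintegral (fun x => g x * cexp (- (n%:~R * x))).

Definition sqnorm (z : R[i]) : R := complex.Re z ^+ 2 + complex.Im z ^+ 2.

(** Membership in [H^s(T)] of an integrable function. *)
Definition sobolev s g : Prop :=
  (\esum_(n in [set: int])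
     ((1 + n%:~R ^+ 2) `^ s * sqnorm (fourier g n))%:E < +oo)%E.

(** [H^{1/2+}] is the union of the [H^s] over [s > 1/2]. *)
Definition sobolev_half_plus g : Prop := exists2 s : R, 1 / 2 < s & sobolev s g.

(** Partial sum over [-N <= n <= N] of the series defining
    [exp(i t L_omega) g]. *)
Definition evolution_partial omega g t (N : nat) x : R[i] :=
  \sum_(k < N.*2.+1) let n : int := k%:Z - N%:Z in
    fourier g n * cexp (t * omega n + n%:~R * x).

(** [u] is the continuous representative of [exp(i t L_omega) g], the series
    being summed in [L^2(T)]; there is at most one such [u]. *)
Definition continuous_evolution omega g t u : Prop :=
  [/\ torus_fun u,
      continuous (fun x => complex.Re (u x)),
      continuous (fun x => complex.Im (u x)) &
      (\int[lebesgue_measure]_(x in `[0%R, (pi *+ 2)%R])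
         (sqnorm (evolution_partial omega g t N x - u x))%:E)%E
        @[N --> \oo] --> (0 : \bar R)].

(** Open Euclidean ball of the plane; the library's [ball] on [R * R] is the
    one of the sup norm. *)
Definition eball (c : R * R) (e : R) : set (R * R) :=
  [set p | Num.sqrt ((p.1 - c.1) ^+ 2 + (p.2 - c.2) ^+ 2) < e].

Definition coverable (E : set (R * R)) (e : R) (n : nat) : Prop :=
  exists c : 'I_n -> R * R, E `<=` \bigcup_(k in [set: 'I_n]) eball (c k) e.

(** The least number of balls of radius [e] covering [E] (with the irrelevant
    value [0] when no finite cover exists, which cannot happen for [E] bounded
    and [e > 0]). *)
Definition covering_number (E : set (R * R)) (e : R) : nat :=
  xget 0%N [set n | coverable E e n /\
                    forall m, coverable E e m -> (n <= m)%N].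

Definition fractal_dim (E : set (R * R)) : \bar R :=
  limf_esup (fun e : R => (ln ((covering_number E e)%:R : R) / ln (1 / e))%:E)
            (0 : R)^'+.

Definition graph_torus (h : R -> R) : set (R * R) :=
  [set p | p.1 \in `[0, pi *+ 2] /\ p.2 = h p.1].

Definition max_graph_dim u : \bar R :=
  Order.max (fractal_dim (graph_torus (fun x => complex.Re (u x))))
            (fractal_dim (graph_torus (fun x => complex.Im (u x)))).

(** [D_t(omega, g) = d]: by uniqueness of the continuous representative, [d] is
    determined by [omega], [g] and [t]; existence of the representative is part
    of the assertion. *)
Definition evolution_dim omega g t (d : \bar R) : Prop :=
  exists2 u, continuous_evolution omega g t u & max_graph_dim u = d.

Definition boussinesq (n : int) : R :=
  Num.sqrt (n%:~R ^+ 2 + n%:~R ^+ 4).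

End Torus.

(* Main.v *)
Require Import Defs.
From HB Require Import structures.
From mathcomp Require Import all_boot all_order all_algebra.
From mathcomp Require Import all_classical all_reals all_analysis.
From mathcomp Require Import complex.
From mathcomp Require Import measurable_realfun.
From mathcomp Require Import ring lra zify.

Set Implicit Arguments.
Unset Strict Implicit.
Unset Printing Implicit Defensive.

Import Order.TTheory GRing.Theory Num.Theory.
Import numFieldNormedType.Exports.
Import Normc.

Local Open Scope classical_set_scope.
Local Open Scope ring_scope.
Local Open Scope complex_scope.

(** Since [sqrt (n^2 + n^4) = n^2 + 1/2 + O(1/n^2)], the Boussinesq phase is the
    Schroedinger phase [t n^2] up to a factor of bounded variation in [n].

    For almost every [t] the Weyl sums [sum_(k < N) exp(i(t k^2 + k x))] are
    [O(N^(1/2+))] uniformly in [x]: van der Corput differencing bounds their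
    square by [sum_(h <= N) 1 / (1/N + |sin (h t)|)], whose integral over a
    bounded range of [t] is [O(N log N)].  Integrating against [dg], whose mass
    is finite because [g] is of bounded variation, and summing by parts, the
    dyadic blocks of the evolution are [O(2^(-j(1/2-)))] in sup norm, so the
    evolution [u] is Hoelder continuous of every exponent below [1/2], and its
    graph has dimension at most [3/2].

    Conversely, a covering number [O(e^(-b))] with [b < 3/2] of both graphs
    bounds the oscillations over columns of width about [e], hence the [L^1] norm
    of [u(x + e) - u(x)].  Interpolating with the sup norm and using Parseval, the
    energy of [g] in the [j]-th dyadic block is [O(eta^j)] with [eta < 1/2],
    which puts [g] in [H^s] for some [s > 1/2].  Parseval is applied on fine
    equispaced grids, so that only finite sums occur. *)

(** * Complex exponentials *)

(** The value 3/2 enters twice through one number, the growth rate [rho] of the Weyl sums over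
    dyadic lengths, which may be any rate above 2^(1/2). From above, columns of width about 2^-J
    oscillate by O((rho/2)^J), so O((2 rho)^J) balls suffice. From below, dimensions less than b
    make the energy of block j equal to O((rho 2^b / 8)^j), which beats 2^-j as soon as rho 2^b < 4.
    As [rho] tends to 2^(1/2), both thresholds tend to 3/2. Almost every t comes from the almost
    everywhere finiteness of a weighted series of majorants, not from rational approximation of t.
    The majorants do not depend on x, and this uniformity is what the pairing with dg requires. The
    measure dg is never built: Fourier coefficients are replaced by finite sums over m cells, summed
    by parts, and the error O(1/m) is sent to 0. Each rate has its own null set and its own limit; a
    sequence of rates and the uniqueness of the uniform limit of the partial sums leave one null set
    and one [u]. *)

Section ComplexModulus.
Variable R : realType.
Implicit Types (z w : R[i]) (x y a b : R).

Lemma normcD z w : normc (z + w) <= normc z + normc w.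
Proof. exact: (@le_normcD R z w). Qed.

Lemma normcN z : normc (- z) = normc z.
Proof. exact: (@normcN R z). Qed.

Lemma normcB z w : normc (z - w) <= normc z + normc w.
Proof. by rewrite (le_trans (normcD _ _))// normcN. Qed.

Lemma normc_distC z w : normc (z - w) = normc (w - z).
Proof. by rewrite -normcN opprB. Qed.

Lemma normc_ge0 z : 0 <= normc z.
Proof. by case: z => a b /=; exact: sqrtr_ge0. Qed.

Lemma sqnormE z : sqnorm z = normc z ^+ 2.
Proof. by case: z => a b /=; rewrite sqr_sqrtr ?addr_ge0 ?sqr_ge0. Qed.

Lemma normc_real x : normc x%:C = `|x|.
Proof. by rewrite /= expr0n /= addr0 sqrtr_sqr. Qed.

Lemma normc_sum I (r : seq I) (P : pred I) (F : I -> R[i]) :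
  normc (\sum_(i <- r | P i) F i) <= \sum_(i <- r | P i) normc (F i).
Proof.
elim/big_rec2: _ => [|i y z _ le]; first by rewrite normc0.
by rewrite (le_trans (normcD _ _))// lerD2l.
Qed.

Lemma normr_Re_le z : `|complex.Re z| <= normc z.
Proof. by case: z => a b /=; rewrite -sqrtr_sqr ler_wsqrtr// lerDl sqr_ge0. Qed.

Lemma normr_Im_le z : `|complex.Im z| <= normc z.
Proof. by case: z => a b /=; rewrite -sqrtr_sqr ler_wsqrtr// lerDr sqr_ge0. Qed.

Lemma normc_le_ReIm z : normc z <= `|complex.Re z| + `|complex.Im z|.
Proof.
have -> : z = (complex.Re z)%:C + (0 +i* complex.Im z).
  by case: z => a b; simpc.
by rewrite (le_trans (normcD _ _))// /= !(expr0n, add0r, addr0)/= !sqrtr_sqr.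
Qed.

Lemma ReB z w : complex.Re (z - w) = complex.Re z - complex.Re w.
Proof. by case: z w => a b []. Qed.

Lemma ImB z w : complex.Im (z - w) = complex.Im z - complex.Im w.
Proof. by case: z w => a b []. Qed.

Lemma Re_sum I (r : seq I) (P : pred I) (F : I -> R[i]) :
  complex.Re (\sum_(i <- r | P i) F i) = \sum_(i <- r | P i) complex.Re (F i).
Proof. by elim/big_rec2: _ => // i x [c d] _ <-; case: (F i) => a b. Qed.

Lemma Im_sum I (r : seq I) (P : pred I) (F : I -> R[i]) :
  complex.Im (\sum_(i <- r | P i) F i) = \sum_(i <- r | P i) complex.Im (F i).
Proof. by elim/big_rec2: _ => // i x [c d] _ <-; case: (F i) => a b. Qed.

Lemma cexp0 : cexp (0 : R) = 1.
Proof. by rewrite /cexp cos0 sin0. Qed.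

Lemma cexpD x y : cexp (x + y) = cexp x * cexp y.
Proof. by rewrite /cexp cosD sinD; simpc; congr (_ +i* _); rewrite addrC. Qed.

Lemma cexpNM x : cexp (- x) * cexp x = 1.
Proof. by rewrite -cexpD addNr cexp0. Qed.

Lemma cexpMn x n : cexp (x *+ n) = cexp x ^+ n.
Proof. by elim: n => [|n IH]; rewrite ?cexp0// mulrSr cexpD IH exprSr. Qed.

Lemma conjc_cexp x : conjc (cexp x) = cexp (- x).
Proof. by rewrite /cexp cosN sinN. Qed.

Lemma normc_cexp x : normc (cexp x) = 1.
Proof. by rewrite /= cos2Dsin2 sqrtr1. Qed.

Lemma cexp2pi : cexp (pi *+ 2 : R) = 1.
Proof. by rewrite /cexp cos2pi sin2pi. Qed.

Lemma cexp2piz (n : int) : cexp (n%:~R * (pi *+ 2) : R) = 1.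
Proof.
rewrite mulrzl; case: n => n; first by rewrite -pmulrn cexpMn cexp2pi expr1n.
by rewrite NegzE mulrNz -pmulrn -conjc_cexp cexpMn cexp2pi expr1n conjc1.
Qed.

Lemma sqnorm_cexpB1 x : sqnorm (cexp x - 1) = 2 - 2 * cos x.
Proof.
rewrite /sqnorm /cexp /= subr0 sqrrB sin2cos2; ring.
Qed.

Lemma normc_cexpB1 x : normc (cexp (x *+ 2) - 1) = 2 * `|sin x|.
Proof.
apply/eqP; rewrite -(@eqrXn2 _ 2) ?normc_ge0 ?mulr_ge0//; apply/eqP.
rewrite -sqnormE sqnorm_cexpB1 exprMn real_normK ?num_real// sin2cos2.
rewrite cos_mulr2n; ring.
Qed.

Lemma sin_le_id x : 0 <= x -> sin x <= x.
Proof.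
rewrite le_eqVlt => /predU1P[<-|x0]; first by rewrite sin0.
have [|c _] := @MVT R sin cos 0 x x0 (fun y _ => is_derive_sin y).
  by apply: continuous_subspaceT => y; exact: continuous_sin.
by rewrite sin0 !subr0 => ->; rewrite ler_piMl ?cos_le1// ltW.
Qed.

Lemma normr_sin_le x : `|sin x| <= `|x|.
Proof.
wlog x0 : x / 0 <= x.
  by move=> H; case: (leP 0 x) => [/H//|x0]; rewrite -normrN -sinN -(normrN x) H//
    oppr_ge0 ltW.
rewrite (ger0_norm x0) ler_norml sin_le_id// andbT lerNl.
case: (leP x 1) => x1.
  rewrite (le_trans _ x0)// oppr_le0 sin_ge0_pi// x0/= (le_trans x1)//.
  by rewrite (le_trans _ (pi_ge2 R))// ler1n.
by rewrite (le_trans _ (ltW x1))// lerNl sin_geN1.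
Qed.

Lemma normc_cexpB x y : normc (cexp x - cexp y) <= `|x - y|.
Proof.
have -> : cexp x - cexp y = cexp y * (cexp ((x - y) / 2 *+ 2) - 1).
  by rewrite -mulr_natr divfK// mulrBr mulr1 -cexpD [y + _]addrC subrK.
rewrite normcM normc_cexp mul1r normc_cexpB1.
apply: le_trans (_ : 2 * `|(x - y) / 2| <= _).
  by rewrite ler_pM2l// normr_sin_le.
by rewrite normrM (ger0_norm (_ : 0 <= 2^-1 :> R))// mulrC divfK.
Qed.

Lemma abel_sum (c z : nat -> R[i]) K :
  \sum_(k < K.+1) c k * z k = c K * (\sum_(k < K.+1) z k) -
    \sum_(k < K) (c k.+1 - c k) * \sum_(l < k.+1) z l.
Proof.
elim: K => [|K IH]; first by rewrite !big_ord_recr !big_ord0/= !add0r subr0.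
rewrite big_ord_recr IH /= (big_ord_recr K.+1) /=.
rewrite (big_ord_recr K (fun i => (c i.+1 - c i) * \sum_(l < i.+1) z l)) /=.
ring.
Qed.

(** A coefficient sequence costs only its last value plus its variation. This is how the phase
    defect and the factors 1/n are carried along a Weyl sum. *)
Lemma abel_sum_bound (c z : nat -> R[i]) K B :
  (forall m, (m <= K.+1)%N -> normc (\sum_(k < m) z k) <= B) ->
  normc (\sum_(k < K.+1) c k * z k) <=
    B * (normc (c K) + \sum_(k < K) normc (c k.+1 - c k)).
Proof.
move=> zB; rewrite abel_sum (le_trans (normcB _ _))// mulrDr lerD//.
  by rewrite normcM mulrC ler_wpM2r ?normc_ge0// zB.
rewrite (le_trans (normc_sum _ _ _))// mulr_sumr ler_sum// => k _.
by rewrite normcM mulrC ler_wpM2r ?normc_ge0// zB// ltnS ltnW.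
Qed.

End ComplexModulus.

(** * Weyl sums *)

Section WeylSums.
Variable R : realType.
Implicit Types (z w : R[i]) (t x : R).

Definition weyl_sum t (N : nat) x : R[i] :=
  \sum_(k < N) cexp (t * k%:R ^+ 2 + k%:R * x).

Lemma sqnormD z w :
  sqnorm (z + w) = sqnorm z + sqnorm w + 2 * complex.Re (w * conjc z).
Proof. by case: z w => a b [c d]; rewrite /sqnorm /=; ring. Qed.

(** Pairs of distinct indices are grouped by their difference [h.+1]. In the induction the new term
    [z N] meets each earlier term once and adds one pair to every difference. *)
Lemma sqnorm_sum_correlation (z : nat -> R[i]) N :
  sqnorm (\sum_(k < N) z k) = \sum_(k < N) sqnorm (z k) +
    2 * complex.Re (\sum_(h < N) \sum_(l < N - h.+1) z (l + h.+1)%N * conjc (z l)).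
Proof.
elim: N => [|N IH].
  by rewrite !big_ord0 /sqnorm/=; ring.
rewrite big_ord_recr/= sqnormD IH [in RHS]big_ord_recr/= -!addrA.
congr (_ + _); rewrite addrC -!addrA; congr (_ + _).
rewrite -mulrDr -!raddfD/=; congr (_ + 2 * complex.Re _).
rewrite [in RHS]big_ord_recr/= subnn big_ord0 addr0.
rewrite rmorph_sum mulr_sumr (reindex_inj rev_ord_inj)/= -big_split/=.
apply: eq_bigr => h _; rewrite subSS.
have hN := ltn_ord h.
have -> : (N - h = (N - h.+1).+1)%N by lia.
rewrite big_ord_recr/= addrC; congr (_ + z _ * _); lia.
Qed.

Lemma geom_sum_le_card w n : normc w = 1 ->
  normc (\sum_(l < n) w ^+ l) <= n%:R.
Proof.
move=> w1; rewrite (le_trans (normc_sum _ _ _))//.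
rewrite (eq_bigr (fun=> 1)) ?sumr_const ?card_ord// => i _.
by elim: (val i) => [|k IH]; rewrite ?normc1// exprS normcM w1 mul1r.
Qed.

Lemma geom_sum_sin_le x n :
  normc (\sum_(l < n) cexp (x *+ 2) ^+ l) * `|sin x| <= 1.
Proof.
have e : cexp (x *+ 2) ^+ n - 1 =
    (cexp (x *+ 2) - 1) * \sum_(l < n) cexp (x *+ 2) ^+ l by rewrite subrX1.
have : normc (cexp (x *+ 2) ^+ n - 1) <= 2.
  by rewrite -cexpMn (le_trans (normcB _ _))// normc_cexp normc1.
rewrite e normcM normc_cexpB1 mulrC mulrCA -[leRHS]mulr1 ler_pM2l//.
Qed.

(** The two elementary bounds, by the number of terms and by the inverse of |sin x|, merge into one
    denominator: each of its summands, times the geometric sum, is at most 1. *)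
Lemma geom_sum_bound x n (m : nat) : (0 < m)%N -> (n <= m)%N ->
  normc (\sum_(l < n) cexp (x *+ 2) ^+ l) <= 2 / (m%:R^-1 + `|sin x|).
Proof.
move=> m0 nm.
have m0R : 0 < m%:R^-1 :> R by rewrite invr_gt0 ltr0n.
rewrite ler_pdivlMr; last by rewrite ltr_pwDl.
rewrite mulrDr (_ : 2 = 1 + 1 :> R)// lerD ?geom_sum_sin_le//.
rewrite ler_pdivrMr ?mul1r ?ltr0n//.
by rewrite (le_trans (geom_sum_le_card _ (normc_cexp _)))// ler_nat.
Qed.

(** At difference h the correlation of a quadratic phase is a unimodular factor times a geometric
    sum of ratio exp(2iht). The point [x] enters only through that factor, so the majorant is a
    function of [t] alone. *)
Definition weyl_majorant (m : nat) t : R :=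
  \sum_(h < m) (m%:R^-1 + `|sin (h.+1%:R * t)|)^-1.

Lemma weyl_sum_le_majorant t x N m : (0 < m)%N -> (N <= m)%N ->
  sqnorm (weyl_sum t N x) <= 6 * weyl_majorant m t.
Proof.
move=> m0 Nm; rewrite /weyl_sum.
have m0R : 0 < m%:R^-1 :> R by rewrite invr_gt0 ltr0n.
have pos h : 0 < m%:R^-1 + `|sin (h%:R * t)| by rewrite ltr_pwDl.
rewrite (sqnorm_sum_correlation (fun k => cexp (t * k%:R ^+ 2 + k%:R * x))).
(* Every summand of the majorant is at least 1/2, so twice the majorant pays for the diagonal terms.
   The other 4 is the 2 in front of the real part times the 2 of [geom_sum_bound]. *)
rewrite (_ : 6 = 2 + 2 * 2 :> R); last by ring.
rewrite [leRHS]mulrDl lerD//.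
  rewrite (eq_bigr (fun=> 1)); last by move=> i _; rewrite sqnormE normc_cexp expr1n.
  rewrite sumr_const card_ord /weyl_majorant mulr_sumr.
  apply: (@le_trans _ _ (\sum_(h < m) (1 : R))).
    by rewrite sumr_const card_ord ler_nat.
  apply: ler_sum => h _; rewrite ler_pdivlMr// mul1r (_ : 2 = 1 + 1 :> R)//.
  by rewrite lerD// ?ler_norml ?sin_geN1 ?sin_le1// invf_le1 ?ltr0n// ler1n.
rewrite -mulrA ler_pM2l// (le_trans (ler_norm _))//.
rewrite (le_trans (normr_Re_le _))// (le_trans (normc_sum _ _ _))//.
rewrite /weyl_majorant mulr_sumr.
pose G h := normc (\sum_(l < N - h.+1)
  cexp (t * (l + h.+1)%:R ^+ 2 + (l + h.+1)%:R * x) *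
  conjc (cexp (t * l%:R ^+ 2 + l%:R * x))).
rewrite -/(\sum_(h < N) G h) (big_ord_widen _ G Nm).
rewrite big_mkcond/=; apply: ler_sum => h _; rewrite /G.
case: ifP => [hN|_]; last by rewrite mulr_ge0 ?invr_ge0// ltW.
have E l : cexp (t * (l + h.+1)%:R ^+ 2 + (l + h.+1)%:R * x) *
    conjc (cexp (t * l%:R ^+ 2 + l%:R * x)) =
    cexp (t * h.+1%:R ^+ 2 + h.+1%:R * x) * cexp ((h.+1%:R * t) *+ 2) ^+ l.
  rewrite conjc_cexp -cexpD -cexpMn -cexpD; congr cexp.
  rewrite natrD -[X in _ = _ + X]mulr_natr -[X in _ = _ + X * _]mulr_natr.
  by move: h.+1%:R l%:R => a b; ring.
rewrite (eq_bigr _ (fun (l : 'I_(N - h.+1)) _ => E l)).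
rewrite -mulr_sumr normcM normc_cexp mul1r geom_sum_bound//.
by rewrite (leq_trans (leq_subr _ _)).
Qed.

End WeylSums.

(** * Mean value of the Weyl majorant in time *)

Section WeylMajorantIntegral.
Variable R : realType.
Implicit Types (a b c d p r s t x : R).

Notation mu := (@lebesgue_measure R).

Lemma within_continuous_inv_affine p b c d :
  (forall t, t \in `[c, d] -> 0 < p + b * t) ->
  {within `[c, d], continuous (fun t => (p + b * t)^-1)}.
Proof.
move=> pos; apply: continuous_in_subspaceT => t; rewrite inE/= => /pos pt.
apply: cvgV; first by rewrite gt_eqF.
by apply: cvgD; [exact: cvg_cst|apply: cvgM; [exact: cvg_cst|exact: cvg_id]].
Qed.

Lemma measurable_inv_affine p b c d :
  (forall t, t \in `[c, d] -> 0 < p + b * t) ->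
  measurable_fun `[c, d]
    (EFin \o (fun t => (p + b * t)^-1)).
Proof.
move=> pos; apply/measurable_EFinP; apply: subspace_continuous_measurable_fun => //.
exact: within_continuous_inv_affine.
Qed.

Lemma integral_inv_affine p b c d : c < d -> b != 0 ->
  (forall t, t \in `[c, d] -> 0 < p + b * t) ->
  (\int[mu]_(t in `[c, d]) ((p + b * t)^-1)%:E =
   ((ln (p + b * d) - ln (p + b * c)) / b)%:E)%E.
Proof.
move=> cd b0 pos.
have cc : c \in `[c, d] by rewrite in_itv/= lexx ltW.
have dd : d \in `[c, d] by rewrite in_itv/= lexx ltW.
pose F := b^-1 \*: (@ln R \o (cst p + b \*: id : R -> R)).
have dF t : t \in `[c, d] -> is_derive t 1 F (p + b * t)^-1.
  move=> /pos pt.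
  have Da : is_derive t 1 (cst p + b \*: id : R -> R) b.
    apply: (is_derive_eq (is_deriveD (is_derive_cst p t 1) (is_deriveZ b (is_derive_id t 1)))).
    by rewrite add0r /GRing.scale/= mulr1.
  apply: (is_derive_eq (is_deriveZ b^-1
    (@is_derive1_comp R (@ln R) (cst p + b \*: id) t _ _ (is_derive1_ln pt) Da))).
  by rewrite /GRing.scale/= mulrCA mulVf ?mulr1.
rewrite mulrC mulrBr EFinB -/(F d) -/(F c).
apply: (@continuous_FTC2 R (fun t => (p + b * t)^-1) F) => //.
- exact: within_continuous_inv_affine.
- split.
  + by move=> t tcd; apply: ex_derive; apply: dF; exact: subset_itv_oo_cc tcd.
  + apply: cvg_at_right_filter; apply: differentiable_continuous.
    by apply/derivable1_diffP; apply: ex_derive; exact: dF.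
  + apply: cvg_at_left_filter; apply: differentiable_continuous.
    by apply/derivable1_diffP; apply: ex_derive; exact: dF.
- move=> t tcd; rewrite derive1E; apply: derive_val; apply: dF.
  exact: subset_itv_oo_cc tcd.
Qed.

(** The mean value theorem gives slope 1/2 up to 1, where the cosine is at least 1/2; past 1
    monotonicity is enough, since x / 4 < 1/2 <= sin 1. *)
Lemma sin_ge_fourth x : 0 <= x <= pi / 2 -> x / 4 <= sin x.
Proof.
move=> /andP[x0 xpi].
have pi2 := @pi_ge2 R; have pi4 := @pihalf_lt2 R.
have half (y : R) : 0 < y <= 1 -> y / 2 <= sin y.
  move=> /andP[y0 y1].
  have [|c + ] := @MVT R sin cos 0 y y0 (fun z _ => is_derive_sin z).
    by apply: continuous_subspaceT => z; exact: continuous_sin.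
  rewrite in_itv/= sin0 !subr0 => /andP[c0 cy] ->.
  rewrite mulrC ler_wpM2r ?(ltW y0)//.
  have cy1 : c <= 1 by rewrite (le_trans (ltW cy)).
  have -> : c = (c / 2) *+ 2 by rewrite -mulr_natr divfK.
  rewrite cos_mulr2n cos2sin2.
  have s1 : sin (c / 2) <= c / 2 by apply: sin_le_id; lra.
  have s0 : 0 <= sin (c / 2) by apply: sin_ge0_pi; apply/andP; split; lra.
  have : sin (c / 2) ^+ 2 <= 2^-1 ^+ 2 by apply: lerXn2r; rewrite ?nnegrE//; lra.
  rewrite expr2 -mulr_natr => sq; lra.
move: x0; rewrite le_eqVlt => /predU1P[<-|x0]; first by rewrite mul0r sin0.
case: (leP x 1) => x1.
  by have := half x; rewrite x0 x1 => /(_ isT); lra.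
have s1 : sin 1 <= sin x.
  rewrite le_eqVlt; apply/orP; right; rewrite ltr_sin// in_itv/=; apply/andP; split; lra.
by have := half 1; rewrite ltr01 lexx => /(_ isT); lra.
Qed.

(* On one half-period the sine dominates a quarter of the distance to its
   zeros, whence the two affine denominators. *)
Lemma inv_sin_le_affine a s : 0 < a -> 0 <= s <= pi ->
  (a + `|sin s|)^-1 <= (a + s / 4)^-1 + (a + (pi - s) / 4)^-1.
Proof.
move=> a0 /andP[s0 spi].
have p1 : 0 < a + s / 4 by lra.
have p2 : 0 < a + (pi - s) / 4 by lra.
have [spi2|spi2] := leP s (pi / 2).
  rewrite -[leLHS]addr0 lerD ?invr_ge0 ?(ltW p1) ?(ltW p2)// lef_pV2 ?posrE//; last first.
    by rewrite ltr_pwDl.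
  by rewrite lerD2l (le_trans _ (ler_norm _))// sin_ge_fourth// s0.
rewrite -[leLHS]add0r lerD ?invr_ge0 ?(ltW p1) ?(ltW p2)// lef_pV2 ?posrE//; last first.
  by rewrite ltr_pwDl.
rewrite lerD2l (le_trans _ (ler_norm _))//.
have -> : sin s = sin (pi - s) by rewrite sinB sinpi cospi mul0r sub0r mulN1r opprK.
by rewrite sin_ge_fourth//; apply/andP; split; lra.
Qed.

Lemma normr_sinDpiz s (n : int) : `|sin (s + n%:~R * pi)| = `|sin s|.
Proof.
have nat_case (k : nat) x : `|sin (x + k%:R * pi)| = `|sin x|.
  elim: k x => [|k IH] x; first by rewrite mul0r addr0.
  rewrite -addn1 natrD mulrDl mul1r addrA sinDpi normrN; exact: IH.
case: n => n; first exact: nat_case.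
rewrite NegzE mulrNz mulNr -[in RHS](subrK (n.+1%:R * pi) s).
by rewrite nat_case.
Qed.

Lemma continuous_inv_sin a b : 0 < a ->
  continuous (fun t => (a + `|sin (b * t)|)^-1).
Proof.
move=> a0 t; apply: cvgV; first by rewrite gt_eqF// ltr_pwDl.
apply: cvgD; first exact: cvg_cst.
apply: cvg_norm; apply: (@continuous_comp _ _ _ (fun t => b * t) sin).
  exact: mulrl_continuous.
exact: continuous_sin.
Qed.

Lemma measurable_inv_sin a b (D : set R) : 0 < a ->
  measurable_fun D (EFin \o (fun t => (a + `|sin (b * t)|)^-1)).
Proof.
move=> a0; apply/measurable_EFinP/measurable_funTS.
by apply: continuous_measurable_fun; exact: continuous_inv_sin.
Qed.

(** The interval joins two consecutive zeros of sin(ht). With a = 2^-j, each affine denominator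
    integrates to 4/h times the logarithm of (a + pi/4)/a, which is of order j. *)
Lemma integral_inv_sin_cell (j h : nat) (n : int) c d : (0 < h)%N ->
  h%:R * c = n%:~R * pi -> h%:R * d = h%:R * c + pi ->
  (\int[mu]_(t in `[c, d])
     (((2 ^ j)%:R^-1 + `|sin (h%:R * t)|)^-1)%:E <=
   (8 * j.+1%:R / h%:R)%:E)%E.
Proof.
move=> h0 hc hd; set a := (2 ^ j)%:R^-1.
have pi0 := @pi_gt0 R.
have hR : 0 < h%:R :> R by rewrite ltr0n.
have a0 : 0 < a by rewrite invr_gt0 ltr0n expn_gt0.
have a1 : a <= 1 by rewrite invf_le1 ?ltr0n ?expn_gt0// ler1n expn_gt0.
have lt : c < d by rewrite -(ltr_pM2l hR) hd ltrDl.
have inI t : t \in `[c, d] -> 0 <= h%:R * t - h%:R * c <= pi.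
  rewrite in_itv/= -(ler_pM2l hR) -[t <= d](ler_pM2l hR) hd => /andP[ct tc].
  by apply/andP; split; lra.
have p1 t : t \in `[c, d] -> 0 < (a - h%:R * c / 4) + h%:R / 4 * t.
  by move=> /inI/andP[u v]; lra.
have p2 t : t \in `[c, d] ->
    0 < (a + (pi + h%:R * c) / 4) + - (h%:R / 4) * t.
  by move=> /inI/andP[u v]; lra.
have le t : t \in `[c, d] -> (a + `|sin (h%:R * t)|)^-1 <=
    ((a - h%:R * c / 4) + h%:R / 4 * t)^-1 +
    ((a + (pi + h%:R * c) / 4) + - (h%:R / 4) * t)^-1.
  move=> /inI tI; have := inv_sin_le_affine a0 tI.
  rewrite {1}hc -mulNr -mulrNz normr_sinDpiz => /le_trans; apply.
  by rewrite le_eqVlt; apply/orP; left; apply/eqP; congr (_^-1 + _^-1); lra.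
have hb : h%:R / 4 != 0 :> R by rewrite mulf_neq0// ?gt_eqF.
have hb' : - (h%:R / 4) != 0 :> R by rewrite oppr_eq0.
apply: (@le_trans _ _ (\int[mu]_(t in `[c, d])
    ((((a - h%:R * c / 4) + h%:R / 4 * t)^-1)%:E +
    (((a + (pi + h%:R * c) / 4) + - (h%:R / 4) * t)^-1)%:E))%E).
  apply: ge0_le_integral => //.
  - by move=> t _; rewrite lee_fin invr_ge0 ltW// ltr_pwDl.
  - exact: measurable_inv_sin.
  - by apply: emeasurable_funD; exact: measurable_inv_affine.
rewrite ge0_integralD//=; first last.
- exact: measurable_inv_affine.
- by move=> t /p2 p; rewrite lee_fin invr_ge0 ltW.
- exact: measurable_inv_affine.
- by move=> t /p1 p; rewrite lee_fin invr_ge0 ltW.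
rewrite (integral_inv_affine lt hb p1) (integral_inv_affine lt hb' p2) -EFinD lee_fin.
have -> : a - h%:R * c / 4 + h%:R / 4 * d = a + pi / 4 by lra.
have -> : a - h%:R * c / 4 + h%:R / 4 * c = a by lra.
have -> : a + (pi + h%:R * c) / 4 + - (h%:R / 4) * d = a by lra.
have -> : a + (pi + h%:R * c) / 4 + - (h%:R / 4) * c = a + pi / 4 by lra.
have a4 : 0 < a + pi / 4 by lra.
(* Here a + pi/4 <= 2 and 1/a = 2^j, so the logarithm is at most (j+1) ln 2. *)
have lnle : ln (a + pi / 4) - ln a <= j.+1%:R.
  rewrite -ln_div ?posrE// (@le_trans _ _ (ln (2 ^+ j.+1)))//.
    have aV : a^-1 = 2 ^+ j by rewrite /a invrK natrX.
    rewrite ler_ln ?posrE ?divr_gt0 ?exprn_gt0// aV exprS ler_pM2r ?exprn_gt0//.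
    by have := @pihalf_lt2 R; lra.
  rewrite lnXn// -[leLHS]mulr_natl -[leRHS]mulr1 ler_wpM2l//.
  by have := @le_ln1Dx R 1; rewrite (_ : 1 + 1 = 2 :> R)//; apply; lra.
have -> : (ln (a + pi / 4) - ln a) / (h%:R / 4) +
   (ln a - ln (a + pi / 4)) / - (h%:R / 4) = 8 * (ln (a + pi / 4) - ln a) / h%:R.
  by field; rewrite gt_eqF.
by rewrite ler_pM2r ?invr_gt0// ler_pM2l.
Qed.

(** The range is cut into 2hm cells of length pi/h. Their number cancels the 1/h of a single cell,
    so the bound does not depend on [h]. *)
Lemma integral_inv_sin (j h m : nat) : (0 < h)%N ->
  (\int[mu]_(t in `[(- (m%:R * pi))%R, (m%:R * pi)%R[)
     (((2 ^ j)%:R^-1 + `|sin (h%:R * t)|)^-1)%:E <=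
   (16 * m%:R * j.+1%:R)%:E)%E.
Proof.
move=> h0; have hR : 0 < h%:R :> R by rewrite ltr0n.
have pi0 := @pi_gt0 R.
have a0 : 0 < (2 ^ j)%:R^-1 :> R by rewrite invr_gt0 ltr0n expn_gt0.
pose p (k : nat) : R := - (m%:R * pi) + k%:R * (pi / h%:R).
have pS k : p k < p k.+1.
  by rewrite ltrD2l ltr_pM2r ?divr_gt0// ltr_nat.
have p0k k : p 0%N <= p k by rewrite lerD2l ler_pM2r ?divr_gt0// ler_nat.
have H k : (\int[mu]_(t in `[p 0%N, p k[)
     (((2 ^ j)%:R^-1 + `|sin (h%:R * t)|)^-1)%:E <=
     (k%:R * (8 * j.+1%:R / h%:R))%:E)%E.
  elim: k => [|k IH].
    by rewrite set_itvco0 integral_set0 mul0r.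
  rewrite (@itv_bndbnd_setU _ _ _ (BLeft (p k))) ?bnd_simp//; last exact: ltW.
  rewrite ge0_integral_setU//=; first last.
  - rewrite disj_set2E; apply/eqP; rewrite predeqE => t; split => /=; last by [].
    by move=> []; rewrite !in_itv/= => /andP[_ tk] /andP[kt _]; rewrite ltNge kt in tk.
  - exact: measurable_inv_sin.
  rewrite -natr1 mulrDl mul1r EFinD leeD//.
  apply: (@le_trans _ _ (\int[mu]_(t in `[p k, p k.+1])
     (((2 ^ j)%:R^-1 + `|sin (h%:R * t)|)^-1)%:E)%E).
    apply: ge0_subset_integral => //.
    - exact: measurable_inv_sin.
    - exact: subset_itv_co_cc.
  apply: (@integral_inv_sin_cell j h (k%:Z - (h * m)%N%:Z)) => //.
    rewrite intrB -!pmulrn natrM /p; field; rewrite ?gt_eqF//.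
  by rewrite /p -natr1; field; rewrite gt_eqF.
have := H (2 * (h * m))%N.
have -> : p 0%N = - (m%:R * pi) by rewrite /p mul0r addr0.
have -> : p (2 * (h * m))%N = m%:R * pi.
  by rewrite /p !natrM; field; rewrite gt_eqF.
have -> // : (2 * (h * m))%:R * (8 * j.+1%:R / h%:R) = 16 * m%:R * j.+1%:R :> R.
by rewrite !natrM; field; rewrite gt_eqF.
Qed.
End WeylMajorantIntegral.

(** * From mean values to almost every time *)

Section AlmostEveryWeylBound.
Variable R : realType.
Implicit Types (r t x : R).

Notation mu := (@lebesgue_measure R).

Lemma measurable_weyl_majorant (j : nat) (D : set R) :
  measurable_fun D (EFin \o @weyl_majorant R (2 ^ j)).
Proof.
have a0 : 0 < (2 ^ j)%:R^-1 :> R by rewrite invr_gt0 ltr0n expn_gt0.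
apply/measurable_EFinP/measurable_sum => h.
by apply/measurable_EFinP; exact: measurable_inv_sin.
Qed.

Lemma weyl_majorant_ge0 m t : 0 <= weyl_majorant m t.
Proof. by apply: sumr_ge0 => h _; rewrite invr_ge0 addr_ge0// invr_ge0. Qed.

Lemma integral_weyl_majorant (j m : nat) :
  (\int[mu]_(t in `[(- (m%:R * pi))%R, (m%:R * pi)%R[)
     (weyl_majorant (2 ^ j) t)%:E <= (16 * m%:R * j.+1%:R * 2 ^+ j)%:E)%E.
Proof.
have a0 : 0 < (2 ^ j)%:R^-1 :> R by rewrite invr_gt0 ltr0n expn_gt0.
under eq_integral do rewrite /weyl_majorant -sumEFin.
rewrite ge0_integral_sum//; last first.
- by move=> h; exact: measurable_inv_sin.
apply: (@le_trans _ _ (\sum_(h < 2 ^ j) (16 * m%:R * j.+1%:R)%:E)%E).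
  by apply: lee_sum => h _; exact: integral_inv_sin.
by rewrite sumEFin lee_fin sumr_const card_ord -[leLHS]mulr_natr natrX.
Qed.

(** A series of nonnegative functions with summable integrals is finite almost everywhere, and then
    each term is bounded by the sum. The ranges [D m] exhaust the line, so countably many null sets
    are discarded. *)
Lemma ae_weyl_majorant r : 0 < r < 1 ->
  {ae mu, forall t, exists C : R, forall j : nat,
    weyl_majorant (2 ^ j) t <= C * (j.+1%:R * (2 / r) ^+ j)}.
Proof.
move=> /andP[r0 r1].
pose D m : set R := `[(- (m%:R * pi))%R, (m%:R * pi)%R[%classic.
have mD m : measurable (D m) by exact: measurable_itv.
(* The integral of the majorant over a bounded range is O((j+1) 2^j); this weight reduces it to
   O(r^j), which is summable. *)
pose c j : R := (r / 2) ^+ j / j.+1%:R.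
have c0 j : 0 < c j by rewrite divr_gt0// exprn_gt0// divr_gt0.
pose f j t := (c j * weyl_majorant (2 ^ j) t)%:E.
have f0 j t : (0 <= f j t)%E by rewrite lee_fin mulr_ge0 ?weyl_majorant_ge0// ltW.
have mf j (E : set R) : measurable_fun E (f j).
  rewrite /f; under eq_fun do rewrite EFinM.
  by apply: measurable_funeM; exact: measurable_weyl_majorant.
have If m j : (\int[mu]_(t in D m) f j t <= (16 * m%:R * r ^+ j)%:E)%E.
  rewrite /f; under eq_integral do rewrite EFinM.
  rewrite ge0_integralZl//; first last.
  - by rewrite lee_fin ltW.
  - by move=> t _; rewrite lee_fin weyl_majorant_ge0.
  - exact: measurable_weyl_majorant.
  - exact: mD.
  rewrite (le_trans (lee_pmul _ _ (lexx _) (integral_weyl_majorant j m)))//.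
  - by rewrite lee_fin ltW.
  - by apply: integral_ge0 => t _; rewrite lee_fin weyl_majorant_ge0.
  rewrite -EFinM lee_fin /c expr_div_n le_eqVlt; apply/orP; left; apply/eqP.
  field; rewrite ?expf_neq0// ?andbT ?nat1r ?pnatr_eq0//.

have H (m : nat) : {ae mu, forall t, D m t -> exists C : R, forall j : nat,
    weyl_majorant (2 ^ j) t <= C * (j.+1%:R * (2 / r) ^+ j)}.
  have intf : (mu.-integrable (D m) (fun t => \sum_(0 <= j <oo) f j t))%E.
    apply/integrableP; split.
      exact: (@ge0_emeasurable_sum _ _ _ (D m) f xpredT
        (fun j t _ _ => f0 j t) (fun j _ => mf j (D m))).
    under eq_integral => t _.
      rewrite gee0_abs; last by apply: nneseries_ge0 => j _ _; exact: f0.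
      over.
    rewrite integral_nneseries; first last.
    - by move=> j t _; exact: f0.
    - by move=> j; exact: mf.
    - exact: mD.
    apply: (@le_lt_trans _ _ ((16 * m%:R / (1 - r))%:E)); last exact: ltry.
    apply: lime_le.
      by apply: is_cvg_nneseries => j _ _; apply: integral_ge0 => t _; exact: f0.
    apply: nearW => n.
    apply: (@le_trans _ _ (\sum_(0 <= j < n) (16 * m%:R * r ^+ j)%:E)%E).
      by apply: lee_sum => j _; exact: If.
    rewrite sumEFin lee_fin.
    have := @geometric_le_lim R n (16 * m%:R) r; apply => //.
    by rewrite gtr0_norm.
  have := integrable_ae _ intf; move=> /(_ (mD m)).
  apply: filterS => t + Dt => /(_ Dt) tfin.
  exists (fine (\sum_(0 <= j <oo) f j t)%E) => j.
  have : (f j t <= \sum_(0 <= j <oo) f j t)%E.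
    apply: (@le_trans _ _ (\sum_(0 <= i < j.+1) f i t)%E).
      by rewrite big_nat_recr//= leeDr// sume_ge0.
    by apply: nneseries_lim_ge.
  rewrite -{1}(fineK tfin) lee_fin /c => le.
  rewrite -ler_pdivrMr; last by rewrite mulr_gt0// exprn_gt0// divr_gt0.
  apply: le_trans le; rewrite le_eqVlt; apply/orP; left; apply/eqP.
  rewrite !expr_div_n; field.
  by rewrite !expf_neq0// gt_eqF.
have := ae_foralln H; apply: filterS => t Ht.
have pi0 := @pi_gt0 R.
have [m Hm] : exists m : nat, `|t| / pi < m%:R.
  by exists (Num.bound (`|t| / pi)); rewrite archi_boundP// divr_ge0// ltW.
apply: (Ht m); rewrite /D/= in_itv/=.
by move: Hm; rewrite ltr_pdivrMr// ltr_norml => /andP[/ltW -> ->].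
Qed.

End AlmostEveryWeylBound.

(** * Fourier coefficients of functions of bounded variation *)

Section RiemannSums.
Variable R : realType.
Implicit Types (f : R -> R) (c d : R).

Notation mu := (@lebesgue_measure R).

Lemma Rintegral_cell_error f c d delta : c <= d ->
  mu.-integrable `]c, d] (EFin \o f) ->
  (forall y, c <= y <= d -> `|f y - f c| <= delta) ->
  `|(\int[mu]_(y in `]c, d]) f y)%R - f c * (d - c)| <= delta * (d - c).
Proof.
move=> cd intf fd.
have mI : fine (mu `]c, d]) = d - c.
  rewrite lebesgue_measure_itv/= lte_fin; case: ltP => //= dc.
  by have -> : c = d by [apply/le_anti/andP]; rewrite subrr.
have fI : (mu `]c, d] < +oo)%E.
  by rewrite lebesgue_measure_itv/=; case: ifP => _; rewrite ?ltry// -EFinB ltry.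
have mD : measurable `]c, d] by exact: measurable_itv.
have ic (x : R) : mu.-integrable `]c, d] (EFin \o cst x).
  apply/integrableP; split; first exact/measurable_EFinP.
  by rewrite /= integral_cst//= lte_mul_pinfty.
have <- : (\int[mu]_(y in `]c, d]) f c)%R = f c * (d - c).
  by rewrite Rintegral_cst// mI.
have <- : (\int[mu]_(y in `]c, d]) delta)%R = delta * (d - c).
  by rewrite Rintegral_cst// mI.
have ib : mu.-integrable `]c, d] (EFin \o (fun y => f y - f c)).
  have := integrableB _ intf (ic (f c)); move=> /(_ mD).
  by under [X in _ -> integrable _ _ X]eq_fun do rewrite /= EFinB.
rewrite -RintegralB//; last exact: ic.
rewrite (le_trans (le_normr_Rintegral _ _))//.
apply: le_Rintegral => //.
- have := integrable_abse ib.
  by apply: eq_integrable.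
- exact: ic.
- by move=> y; rewrite /= in_itv/= => /andP[cy yd]; apply: fd; rewrite yd ltW.
Qed.

Lemma Riemann_sum_error f (y delta : nat -> R) m :
  {homo y : i j / (i <= j)%N >-> i <= j} ->
  mu.-integrable `[y 0%N, y m] (EFin \o f) ->
  (forall k, (k < m)%N -> forall x, y k <= x <= y k.+1 ->
    `|f x - f (y k)| <= delta k) ->
  `|(\int[mu]_(x in `[y 0%N, y m]) f x)%R -
    \sum_(k < m) f (y k) * (y k.+1 - y k)| <=
  \sum_(k < m) delta k * (y k.+1 - y k).
Proof.
move=> ndy; elim: m => [|m IH] intf fd.
  by rewrite !big_ord0 set_itv1 Rintegral_set1 subrr normr0.
rewrite !big_ord_recr/=.
have intf1 : mu.-integrable `[y 0%N, y m] (EFin \o f).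
  apply: integrableS intf => //.
  by apply: subset_itvl; rewrite bnd_simp ndy.
have intf2 : mu.-integrable `]y m, y m.+1] (EFin \o f).
  apply: integrableS intf => //.
  by apply: subset_itvr; rewrite bnd_simp ndy.
have E := @Rintegral_itvB _ f (BLeft (y 0%N)) (BRight (y m.+1)) (y m) intf.
rewrite !bnd_simp !ndy// in E; have {}E := E isT isT.
have {1}-> : (\int[mu]_(x in `[y 0%N, y m.+1]) f x)%R =
   (\int[mu]_(x in `[y 0%N, y m]) f x)%R + (\int[mu]_(x in `]y m, y m.+1]) f x)%R.
  by rewrite -E addrC subrK.
rewrite opprD addrACA (le_trans (ler_normD _ _))// lerD//.
  by apply: IH => // k km; apply: fd; rewrite ltnS ltnW.
by apply: Rintegral_cell_error; rewrite ?ndy//; exact: fd.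
Qed.

End RiemannSums.

Section BoundedVariationFourier.
Variable R : realType.
Implicit Types (f : R -> R) (g : R -> R[i]).

Notation mu := (@lebesgue_measure R).

(** [W] is the variation from 0. In this form the hypothesis is a real inequality whose right side
    telescopes over a partition. *)
Lemma bounded_variation_control f (T : R) : bounded_variation 0 T f ->
  exists W : R -> R, forall x y, 0 <= x -> x <= y -> y <= T ->
    `|f y - f x| <= W y - W x.
Proof.
move=> bv; exists (fun y => fine (total_variation 0 y f)) => x y x0 xy yT.
have fin z : 0 <= z -> z <= T -> total_variation 0 z f \is a fin_num.
  move=> z0 zT; apply/bounded_variationP => //.
  exact: bounded_variationl zT bv.
have y0 : 0 <= y by exact: le_trans xy.
have xT : x <= T by exact: le_trans yT.
have TVxy : total_variation x y f \is a fin_num.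
  apply/bounded_variationP => //; apply: bounded_variationl yT _ => //.
  exact: bounded_variationr x0 xT bv.
rewrite (total_variationD _ x0 xy) fineD ?fin// addrAC subrr add0r.
by rewrite -lee_fin fineK// total_variation_ge.
Qed.

(** Jordan decomposition: W and W - f are nondecreasing. Clamping the argument to [0, T] by [cl]
    makes them monotone on the whole line, hence measurable. *)
Lemma measurable_control f W (T : R) : 0 <= T ->
  (forall x y, 0 <= x -> x <= y -> y <= T -> `|f y - f x| <= W y - W x) ->
  measurable_fun `[0, T] f.
Proof.
move=> T0 fW.
pose cl x : R := Num.max 0 (Num.min x T).
have cl0 x : 0 <= cl x by rewrite le_max lexx.
have clT x : cl x <= T by rewrite ge_max T0 ge_min lexx orbT.
have ndcl x y : x <= y -> cl x <= cl y.
  move=> xy; rewrite /cl; case: (leP x T) => xT; case: (leP y T) => yT;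
    rewrite !maxEle; do ![case: ifPn; rewrite -?ltNge => ?]; lra.
have m1 : measurable_fun setT (W \o cl).
  apply: nondecreasing_measurable => // x y /ndcl xy /=.
  by rewrite -subr_ge0 (le_trans _ (fW _ _ _ xy _)).
have m2 : measurable_fun setT ((W \o cl) \- (f \o cl)).
  apply: nondecreasing_measurable => // x y /ndcl xy /=.
  have := fW _ _ (cl0 x) xy (clT y).
  by move=> /(le_trans (ler_norm _)); lra.
have m3 : measurable_fun setT (f \o cl).
  have := measurable_funB m1 m2; congr measurable_fun.
  by apply/funext => x /=; lra.
apply: eq_measurable_fun (measurable_funS measurableT (@subsetT _ _) m3).
move=> x; rewrite inE/= in_itv/= => /andP[x0 xT].
by rewrite /cl min_l// max_r.
Qed.

Lemma cexp_taylor1 (x : R) : normc (cexp x - 1 - 0 +i* x) <= 2 * x ^+ 2.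
Proof.
rewrite (le_trans (normc_le_ReIm _))//= !subr0.
have c1 : `|cos x - 1| <= x ^+ 2.
  rewrite [in cos x](_ : x = (x / 2) *+ 2); last by rewrite -mulr_natr divfK.
  have : sin (x / 2) ^+ 2 <= (x / 2) ^+ 2.
    rewrite -(real_normK (num_real (sin _))) -[leRHS](real_normK (num_real _)).
    by rewrite lerXn2r ?nnegrE// normr_sin_le.
  have := sqr_ge0 (sin (x / 2)); have := sqr_ge0 x.
  rewrite cos_mulr2n cos2sin2 -mulr_natr ler_norml expr_div_n.
  by move: (sin _ ^+ 2) (x ^+ 2) => u v *; lra.
have si (y : R) : 0 < y -> `|sin y - y| <= y ^+ 2.
  move=> y0; have [|c + ] := @MVT R sin cos 0 y y0 (fun z _ => is_derive_sin z).
    by apply: continuous_subspaceT => z; exact: continuous_sin.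
  rewrite in_itv/= sin0 !subr0 => /andP[c0 cy] ->.
  have -> : cos c * y - y = (cos c - 1) * y by ring.
  rewrite normrM (gtr0_norm y0) expr2 ler_pM2r// (le_trans _ (ltW cy))//.
  rewrite -[leRHS]gtr0_norm// -[c in leRHS]subr0.
  rewrite (le_trans _ (normc_cexpB _ _))// (le_trans _ (normr_Re_le _))//.
  by rewrite ReB /= cos0.
have s1 : `|sin x - x| <= x ^+ 2.
  have [x0|x0|->] := ltgtP x 0; last 2 first.
  - exact: si.
  - by rewrite sin0 subrr normr0 expr0n.
  have := si (- x); rewrite oppr_gt0 x0 sinN sqrrN -opprD normrN; exact.
lra.
Qed.

Lemma cintegral_Riemann (h : R -> R[i]) (m : nat) L (delta : nat -> R) (G : R) :
  (0 < m)%N -> L = pi *+ 2 / m%:R ->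
  measurable_fun `[0, pi *+ 2] (fun x => complex.Re (h x)) ->
  measurable_fun `[0, pi *+ 2] (fun x => complex.Im (h x)) ->
  (forall x, 0 <= x <= pi *+ 2 -> normc (h x) <= G) ->
  (forall k, (k < m)%N -> forall x, k%:R * L <= x <= k.+1%:R * L ->
    normc (h x - h (k%:R * L)) <= delta k) ->
  normc (cintegral h - \sum_(k < m) h (k%:R * L) * L%:C) <=
    2 * (L * \sum_(k < m) delta k).
Proof.
move=> m0 LE mRe mIm hG hd.
have pi0 := @pi_gt0 R.
have L0 : 0 < L by rewrite LE divr_gt0 ?ltr0n// mulrn_wgt0.
pose y k : R := k%:R * L.
have y0 : y 0%N = 0 by rewrite /y mul0r.
have ym : y m = pi *+ 2 by rewrite /y LE mulrC divfK// gt_eqF// ltr0n.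
have yS k : y k.+1 - y k = L by rewrite /y -mulrBl -natrB// subSnn mul1r.
have ndy : {homo y : i j / (i <= j)%N >-> i <= j}.
  by move=> i j ij; rewrite /y ler_pM2r// ler_nat.
have fI : (mu `[0%R, (pi *+ 2)%R] < +oo)%E.
  by rewrite lebesgue_measure_itv/=; case: ifP => _; rewrite ?ltry// -EFinB ltry.
have key (f : R -> R) : measurable_fun `[0, pi *+ 2] f ->
    (forall x, 0 <= x <= pi *+ 2 -> `|f x| <= G) ->
    (forall k, (k < m)%N -> forall x, y k <= x <= y k.+1 ->
      `|f x - f (y k)| <= delta k) ->
    `|(\int[mu]_(x in `[0, (pi *+ 2)%R]) f x)%R - \sum_(k < m) f (y k) * L| <=
    L * \sum_(k < m) delta k.
  move=> mf fG fd.
  have intf : mu.-integrable `[y 0%N, y m] (EFin \o f).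
    rewrite y0 ym; apply: measurable_bounded_integrable => //.
    exists G; split; first exact: num_real.
      move=> M GM x; rewrite /= in_itv/= => xI.
      exact: le_trans (fG _ xI) (ltW GM).
  have := Riemann_sum_error ndy intf fd.
  rewrite y0 ym mulr_sumr.
  under eq_bigr do rewrite yS.
  by under [X in _ <= X -> _]eq_bigr do rewrite yS mulrC.
rewrite (le_trans (normc_le_ReIm _))// mulr_natl mulr2n lerD//.
- rewrite ReB Re_sum /cintegral/=.
  have -> : \sum_(k < m) complex.Re (h (k%:R * L) * L%:C) =
      \sum_(k < m) complex.Re (h (y k)) * L.
    by apply: eq_bigr => k _; rewrite /y; case: (h _) => a b/=; ring.
  apply: (key (fun x => complex.Re (h x))) => //.
  + by move=> x /hG; apply: le_trans; exact: normr_Re_le.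
  + by move=> k km x /(hd _ km); apply: le_trans; rewrite -ReB normr_Re_le.
- rewrite ImB Im_sum /cintegral/=.
  have -> : \sum_(k < m) complex.Im (h (k%:R * L) * L%:C) =
      \sum_(k < m) complex.Im (h (y k)) * L.
    by apply: eq_bigr => k _; rewrite /y; case: (h _) => a b/=; ring.
  apply: (key (fun x => complex.Im (h x))) => //.
  + by move=> x /hG; apply: le_trans; exact: normr_Im_le.
  + by move=> k km x /(hd _ km); apply: le_trans; rewrite -ImB normr_Im_le.
Qed.

End BoundedVariationFourier.

Section FourierSums.
Variable R : realType.
Variable g : R -> R[i].
Hypothesis gBV : BV_torus g.

Lemma BV_torus_control : exists W : R -> R,
  [/\ forall x y, 0 <= x -> x <= y -> y <= pi *+ 2 ->
        normc (g y - g x) <= W y - W x,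
      measurable_fun `[0, pi *+ 2] (fun x => complex.Re (g x)) &
      measurable_fun `[0, pi *+ 2] (fun x => complex.Im (g x))].
Proof.
have pi0 : 0 <= pi *+ 2 :> R by rewrite mulrn_wge0// pi_ge0.
case: gBV => _ /bounded_variation_control[W1 H1] /bounded_variation_control[W2 H2].
exists (W1 \+ W2); split.
- move=> x y x0 xy yT; rewrite (le_trans (normc_le_ReIm _))// ReB ImB /=.
  rewrite opprD addrACA lerD//; [exact: H1|exact: H2].
- exact: measurable_control H1.
- exact: measurable_control H2.
Qed.

(** The increment of exp(-inx) over a cell, times i/n, is the exact integral of the exponential
    there, so only [g] is sampled. Increments in place of samples are what summation by parts will
    move onto [g]. *)
Lemma fourier_discretization (W : R -> R) (G : R) (n : int) :
  (forall x y, 0 <= x -> x <= y -> y <= pi *+ 2 ->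
    normc (g y - g x) <= W y - W x) ->
  measurable_fun `[0, pi *+ 2] (fun x => complex.Re (g x)) ->
  measurable_fun `[0, pi *+ 2] (fun x => complex.Im (g x)) ->
  (forall x, 0 <= x <= pi *+ 2 -> normc (g x) <= G) ->
  n != 0 ->
  exists C : R, forall (m : nat) (L : R), (0 < m)%N -> L = pi *+ 2 / m%:R ->
    normc ((pi *+ 2)%:C * fourier g n - \sum_(k < m) g (k%:R * L) *
      ((cexp (- (n%:~R * (k.+1%:R * L))) - cexp (- (n%:~R * (k%:R * L)))) *
       (0 +i* n%:~R^-1))) <= C / m%:R.
Proof.
move=> gW mRe mIm gG n0.
set P : R := pi *+ 2; set nu : R := n%:~R.
have P0 : 0 < P by rewrite mulrn_wgt0// pi_gt0.
have nu0 : nu != 0 by rewrite intr_eq0.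
exists (2 * P * (W P - W 0) + 4 * (G * `|nu| * P ^+ 2)) => m L m0 LE.
have mR : 0 < m%:R :> R by rewrite ltr0n.
have L0 : 0 < L by rewrite LE divr_gt0.
have LP : m%:R * L = P by rewrite LE mulrC divfK// gt_eqF.
have G0 : 0 <= G by rewrite (le_trans (normc_ge0 _) (gG 0 _))// lexx ltW.
pose h x := g x * cexp (- (nu * x)).
have E : P%:C * fourier g n = cintegral h.
  rewrite /fourier -/h mulrA -rmorphM/= divff ?gt_eqF//.
  by rewrite mul1r.
have cellI k x : (k < m)%N -> k%:R * L <= x <= k.+1%:R * L ->
    [/\ 0 <= k%:R * L, k%:R * L <= x, x <= k.+1%:R * L & k.+1%:R * L <= P].
  move=> km /andP[kx xk]; split => //; first by rewrite mulr_ge0// ltW.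
  by rewrite -LP ler_pM2r// ler_nat.
pose delta k := W (k.+1%:R * L) - W (k%:R * L) + G * (`|nu| * L).
have mh : measurable_fun `[0, P] (fun x => complex.Re (h x)) /\
   measurable_fun `[0, P] (fun x => complex.Im (h x)).
  have mc : measurable_fun `[0, P] (fun x => cos (- (nu * x))).
    apply: measurable_funTS; apply: continuous_measurable_fun => x.
    apply: (@continuous_comp _ _ _ (fun x => - (nu * x)) cos).
      by apply: cvgN; exact: mulrl_continuous.
    exact: continuous_cos.
  have ms : measurable_fun `[0, P] (fun x => sin (- (nu * x))).
    apply: measurable_funTS; apply: continuous_measurable_fun => x.
    apply: (@continuous_comp _ _ _ (fun x => - (nu * x)) sin).
      by apply: cvgN; exact: mulrl_continuous.
    exact: continuous_sin.
  have -> : (fun x => complex.Re (h x)) = (fun x =>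
      complex.Re (g x) * cos (- (nu * x)) - complex.Im (g x) * sin (- (nu * x))).
    by apply/funext => x; rewrite /h; case: (g x).
  have -> : (fun x => complex.Im (h x)) = (fun x =>
      complex.Re (g x) * sin (- (nu * x)) + complex.Im (g x) * cos (- (nu * x))).
    by apply/funext => x; rewrite /h; case: (g x) => a b /=.
  split.
  - by apply: measurable_funB; apply: measurable_funM.
  - by apply: measurable_funD; apply: measurable_funM.
have hG x : 0 <= x <= P -> normc (h x) <= G.
  by move=> xI; rewrite /h normcM normc_cexp mulr1; exact: gG.
have hd k : (k < m)%N -> forall x, k%:R * L <= x <= k.+1%:R * L ->
    normc (h x - h (k%:R * L)) <= delta k.
  move=> km x /(cellI _ _ km)[k0 kx xk kP].
  have -> : h x - h (k%:R * L) = (g x - g (k%:R * L)) * cexp (- (nu * x)) +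
      g (k%:R * L) * (cexp (- (nu * x)) - cexp (- (nu * (k%:R * L)))).
    by rewrite /h; ring.
  rewrite (le_trans (normcD _ _))// lerD// normcM.
    rewrite normc_cexp mulr1 (le_trans (gW _ _ _ kx _))// ?(le_trans xk)//.
    rewrite lerD2r -subr_ge0.
    by rewrite (le_trans _ (gW x _ _ xk _))// ?normc_ge0// (le_trans k0).
  rewrite ler_pM ?normc_ge0//.
    by apply: gG; rewrite k0/= (le_trans kx)// (le_trans xk).
  rewrite (le_trans (normc_cexpB _ _))//.
  have -> : - (nu * x) - - (nu * (k%:R * L)) = - (nu * (x - k%:R * L)) by ring.
  rewrite normrN normrM ler_wpM2l// ger0_norm ?subr_ge0// lerBlDl.
  by rewrite (le_trans xk)// -natr1; lra.
have D1 := @cintegral_Riemann R h m L delta G m0 LE mh.1 mh.2 hG hd.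
have sdelta : \sum_(k < m) delta k = W P - W 0 + m%:R * (G * (`|nu| * L)).
  rewrite big_split/= sumr_const card_ord -[X in _ + X]mulr_natl; congr (_ + _).
  rewrite -(big_mkord xpredT (fun k => W (k.+1%:R * L) - W (k%:R * L))).
  by rewrite (telescope_sumr (fun k : nat => W (k%:R * L)))// LP mul0r.
rewrite E.
(* Both sides are compared with the plain Riemann sum of g(x) exp(-inx): [D1] uses the variation of
   [g], [D2] the Taylor error of the exponential over one cell. *)
rewrite -[_ - _](subrKA (\sum_(k < m) h (k%:R * L) * L%:C)).
rewrite (le_trans (normcD _ _))//.
have D2 : normc (\sum_(k < m) h (k%:R * L) * L%:C -
   \sum_(k < m) g (k%:R * L) *
      ((cexp (- (nu * (k.+1%:R * L))) - cexp (- (nu * (k%:R * L)))) *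
       (0 +i* nu^-1))) <= m%:R * (G * (2 * (`|nu| * L ^+ 2))).
  rewrite -sumrB (le_trans (normc_sum _ _ _))//.
  rewrite -[X in X%:R * _](card_ord m) mulr_natl -sumr_const ler_sum// => k _.
  have km := ltn_ord k.
  have th : L%:C = (0 +i* - (nu * L)) * (0 +i* nu^-1) :> R[i].
    simpc; congr (_ +i* _).
    by field.
  have ck : cexp (- (nu * (k.+1%:R * L))) =
      cexp (- (nu * (k%:R * L))) * cexp (- (nu * L)).
    by rewrite -cexpD; congr cexp; rewrite -natr1; ring.
  rewrite /h ck th.
  rewrite [X in normc X](_ : _ = - (g (k%:R * L) * cexp (- (nu * (k%:R * L))) *
    ((cexp (- (nu * L)) - 1 - 0 +i* (- (nu * L))) * (0 +i* nu^-1)))); last by ring.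
  rewrite normcN !normcM normc_cexp mulr1.
  have kk : k%:R * L <= k%:R * L <= k.+1%:R * L by rewrite lexx/= ler_pM2r// ler_nat.
  have [k0 _ _ kP] := cellI _ _ km kk.
  rewrite ler_pM ?mulr_ge0 ?normc_ge0//.
    by apply: gG; rewrite k0/= (le_trans _ kP)// ler_pM2r// ler_nat.
  have -> : normc (0 +i* nu^-1) = `|nu|^-1.
    by rewrite /= expr0n/= add0r sqrtr_sqr normfV.
  rewrite ler_pdivrMr ?normr_gt0// (le_trans (cexp_taylor1 _))//.
  by rewrite sqrrN exprMn -(real_normK (num_real nu)); lra.
rewrite (le_trans (lerD D1 D2))// sdelta.
rewrite le_eqVlt; apply/orP; left; apply/eqP.
by rewrite LE; field; rewrite gt_eqF.
Qed.

Lemma ler_addDiv_nat (a b C : R) :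
  (forall m : nat, (0 < m)%N -> a <= b + C / m%:R) -> a <= b.
Proof.
move=> H; rewrite leNgt; apply/negP => ba.
have d0 : 0 < a - b by rewrite subr_gt0.
pose m := (Num.bound (`|C| / (a - b))).+1.
have : `|C| / (a - b) < m%:R.
  rewrite (@lt_trans _ _ (Num.bound (`|C| / (a - b)))%:R) ?ltr_nat//.
  by rewrite archi_boundP// divr_ge0// ltW.
rewrite ltr_pdivrMr// => lt.
have := H m isT; rewrite -lerBlDl ler_pdivlMr ?ltr0n// mulrC leNgt => /negP; apply.
exact: le_lt_trans (ler_norm _) lt.
Qed.

(** Integration by parts against dg: a combination of Fourier coefficients becomes the integral of a
    trigonometric sum with coefficients b/n, for which a sup bound suffices. [V] dominates the
    variation of [g] over a period. *)
Lemma fourier_sum_bound : exists2 V : R, 0 <= V &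
  forall (K : nat) (n : nat -> int) (b : nat -> R[i]) (B : R),
    (forall k, (k < K)%N -> n k != 0) ->
    (forall y, normc (\sum_(k < K) b k * ((n k)%:~R^-1)%:C *
       cexp (- ((n k)%:~R * y))) <= B) ->
    normc (\sum_(k < K) b k * fourier g (n k)) <= V * B.
Proof.
have [W [gW mRe mIm]] := BV_torus_control.
set P : R := pi *+ 2 in gW mRe mIm.
have P4 : 4 <= P by rewrite /P -mulr_natr; have := @pi_ge2 R; lra.
have P0 : 0 < P by rewrite (lt_le_trans _ P4).
have W0 : 0 <= W P - W 0.
  by rewrite (le_trans _ (gW 0 P _ _ _))// ?normc_ge0// ltW.
exists (W P - W 0) => // K n b B n0 bB.
have gG x : 0 <= x <= P -> normc (g x) <= normc (g 0) + (W P - W 0).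
  move=> /andP[x0 xP]; rewrite -[g x](subrK (g 0)) addrC (le_trans (normcD _ _))//.
  rewrite lerD2l (le_trans (gW _ _ _ x0 xP))// lerD2r -subr_ge0.
  by rewrite (le_trans _ (gW x P _ _ _))// normc_ge0.
pose D (m : nat) (L : R) (nu : R) := \sum_(j < m) g (j%:R * L) *
   ((cexp (- (nu * (j.+1%:R * L))) - cexp (- (nu * (j%:R * L)))) * (0 +i* nu^-1)).
have [C HC] : exists C, forall (m : nat) (L : R), (0 < m)%N -> L = P / m%:R ->
   normc (P%:C * \sum_(k < K) b k * fourier g (n k) -
     \sum_(k < K) b k * D m L (n k)%:~R) <= C / m%:R.
  elim: (K) n0 => [|K' IH] n0.
    by exists 0 => m L _ _; rewrite !big_ord0 mulr0 subrr normc0 mul0r.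
  have [C1 H1] := IH (fun k kK => n0 k (ltnW kK)).
  have [C2 H2] := fourier_discretization gW mRe mIm gG (n0 K' (ltnSn _)).
  exists (C1 + normc (b K') * C2) => m L m0 LE.
  rewrite !big_ord_recr/= mulrDr opprD addrACA (le_trans (normcD _ _))// mulrDl.
  rewrite lerD ?H1// mulrCA -mulrBr normcM -mulrA ler_wpM2l ?normc_ge0//.
  exact: H2.
pose F y := \sum_(k < K) b k * (0 +i* ((n k)%:~R^-1)) * cexp (- ((n k)%:~R * y)).
have FB y : normc (F y) <= B.
  rewrite -[leLHS]mul1r.
  have <- : normc (0 +i* (-1) : R[i]) = 1.
    by rewrite /= expr0n/= sqrrN expr1n add0r sqrtr1.
  rewrite -normcM mulr_sumr; have := bB y; congr (normc _ <= _).
  apply: eq_bigr => k _.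
  have -> : ((n k)%:~R^-1)%:C = (0 +i* (-1)) * (0 +i* (n k)%:~R^-1) :> R[i].
    by simpc.
  by ring.
(* Integer frequencies make [F] periodic; together with the periodicity of [g] this cancels the
   boundary terms of the summation by parts. *)
have FP : F P = F 0.
  apply: eq_bigr => k _; rewrite mulr0 oppr0 cexp0.
  by rewrite -mulNr -mulrNz cexp2piz.
have gP : g P = g 0 by case: gBV => gper _ _; rewrite -[P]add0r gper.
have B0 : 0 <= B by rewrite (le_trans (normc_ge0 _) (bB 0)).
(* Multiplying by 2 pi >= 1 only enlarges the left side and clears the normalization of the Fourier
   coefficients. *)
suff H : normc (P%:C * \sum_(k < K) b k * fourier g (n k)) <= (W P - W 0) * B.
  apply: le_trans H; rewrite normcM normc_real gtr0_norm//.
  by rewrite ler_peMl ?normc_ge0// (le_trans _ P4)// ler1n.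
apply: (@ler_addDiv_nat _ _ C) => m m0.
set L := P / m%:R.
have mR : 0 < m%:R :> R by rewrite ltr0n.
have L0 : 0 < L by rewrite divr_gt0.
have LP : m%:R * L = P by rewrite mulrC divfK// gt_eqF.
rewrite -[X in normc X](subrK (\sum_(k < K) b k * D m L (n k)%:~R)) addrC.
rewrite (le_trans (normcD _ _))// lerD//; last exact: HC.
have -> : \sum_(k < K) b k * D m L (n k)%:~R =
    \sum_(j < m) g (j%:R * L) * (F (j.+1%:R * L) - F (j%:R * L)).
  under eq_bigr do rewrite mulr_sumr.
  rewrite exchange_big/=; apply: eq_bigr => j _.
  rewrite -sumrB mulr_sumr; apply: eq_bigr => k _; ring.
have abel (u v : nat -> R[i]) p : \sum_(j < p) u j * (v j.+1 - v j) =
    u p * v p - u 0%N * v 0%N - \sum_(j < p) (u j.+1 - u j) * v j.+1.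
  elim: p => [|p IH]; first by rewrite !big_ord0; ring.
  rewrite big_ord_recr/= IH [in RHS]big_ord_recr/=; ring.
rewrite (abel (fun j => g (j%:R * L)) (fun j => F (j%:R * L))) LP mul0r gP FP subrr sub0r.
rewrite normcN (le_trans (normc_sum _ _ _))//.
apply: (@le_trans _ _ (\sum_(j < m) (W (j.+1%:R * L) - W (j%:R * L)) * B)).
  apply: ler_sum => j _; rewrite normcM ler_pM ?normc_ge0//.
  apply: gW; first by rewrite mulr_ge0// ltW.
    by rewrite ler_pM2r// ler_nat.
  by rewrite -LP ler_pM2r// ler_nat.
rewrite -mulr_suml -(big_mkord xpredT (fun k => W (k.+1%:R * L) - W (k%:R * L))).
by rewrite (telescope_sumr (fun k : nat => W (k%:R * L)))// LP mul0r.
Qed.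
End FourierSums.

(** * Dyadic blocks of the evolution *)

Section BlockBounds.
Variable R : realType.
Implicit Types (t x y rho C A V : R).

Notation mu := (@lebesgue_measure R).

Lemma ae_lebesgue_imply (P Q : R -> Prop) : (forall t, P t -> Q t) ->
  {ae mu, forall t, P t} -> {ae mu, forall t, Q t}.
Proof.
by move=> PQ; apply: (@filterS _ _ (ae_filter_ringOfSetsType mu)); exact: PQ.
Qed.

(** All lengths up to 2^j are included because summation by parts sees every partial sum; the bound
    is uniform in [x] because translating a block changes the point. *)
Definition weyl_bound t rho C : Prop := forall (j N : nat) x, (N <= 2 ^ j)%N ->
  normc (weyl_sum t N x) <= C * rho ^+ j.

(** Each of the first j+1 powers of [r] is at least r^j, so the left side stays below the geometric
    series. This absorbs a factor j+1 at the price of a slightly worse rate. *)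
Lemma nat_geometric_bound (r : R) (j : nat) : 0 < r < 1 ->
  j.+1%:R * r ^+ j <= (1 - r)^-1.
Proof.
move=> /andP[r0 r1].
have rle : `|r| < 1 by rewrite gtr0_norm.
have := @geometric_le_lim R j.+1 1 r ler01 r0 rle.
rewrite div1r; apply: le_trans; rewrite /series/= big_mkord.
rewrite mulr_natl -[j.+1 in leLHS]card_ord -sumr_const; apply: ler_sum => i _.
by rewrite mul1r ler_wiXn2l// ?ltW// -ltnS.
Qed.

Lemma ae_weyl_bound rho : 0 < rho -> 2 < rho ^+ 2 ->
  {ae mu, forall t, exists2 C, 0 <= C & weyl_bound t rho C}.
Proof.
move=> rho0 rho2.
(* This makes rho^2 = (2/r)/r: the majorant grows at most like (j+1) (2/r)^j, and the spare r^j
   absorbs j+1. *)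
pose r := Num.sqrt (2 / rho ^+ 2).
have r2 : r ^+ 2 = 2 / rho ^+ 2 by rewrite sqr_sqrtr// divr_ge0// sqr_ge0.
have r0 : 0 < r by rewrite sqrtr_gt0 divr_gt0// exprn_gt0.
have r1 : r < 1.
  rewrite -(@ltr_pXn2r _ 2) ?nnegrE ?ltW// r2 expr1n ltr_pdivrMr ?mul1r//.
  by rewrite exprn_gt0.
have r01 : 0 < r < 1 by rewrite r0.
have := ae_weyl_majorant r01; apply: ae_lebesgue_imply => t [D HD].
have d0 : 0 <= `|D| / (1 - r) by rewrite divr_ge0// subr_ge0 ltW.
exists (Num.sqrt (6 * (`|D| / (1 - r)))); first exact: sqrtr_ge0.
move=> j N x Nj.
rewrite -(@ler_pXn2r _ 2) ?nnegrE ?normc_ge0 ?mulr_ge0 ?sqrtr_ge0 ?exprn_ge0 ?(ltW rho0)//.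
rewrite -sqnormE exprMn sqr_sqrtr ?(mulr_ge0 _ d0)//.
rewrite (le_trans (weyl_sum_le_majorant _ _ _ Nj)) ?expn_gt0//.
rewrite -[leRHS]mulrA ler_pM2l// (le_trans (HD j))//.
have e : rho ^+ j ^+ 2 = (2 / r) ^+ j / r ^+ j.
  rewrite -expr_div_n -exprM mulnC exprM; congr (_ ^+ _).
  have -> : 2 / r / r = 2 / r ^+ 2 by field; rewrite gt_eqF.
  by rewrite r2; field; rewrite gt_eqF.
rewrite (le_trans (ler_wpM2r _ (ler_norm D)))//.
  by rewrite mulr_ge0// exprn_ge0// divr_ge0// ltW.
rewrite -[leRHS]mulrA ler_wpM2l// e mulrCA [leLHS]mulrC ler_wpM2l//.
  by rewrite exprn_ge0// divr_ge0// ltW.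
by rewrite ler_pdivlMr ?exprn_gt0// nat_geometric_bound.
Qed.

(* The Boussinesq dispersion is [n ^ 2] up to a phase of bounded variation. *)
Definition boussinesq_defect (m : nat) : R :=
  boussinesq R m%:Z - m%:R ^+ 2.

Lemma boussinesqE (s : bool) (m : nat) :
  boussinesq R ((-1) ^+ s * m%:Z) = m%:R ^+ 2 + boussinesq_defect m.
Proof.
rewrite /boussinesq_defect addrC subrK /boussinesq.
rewrite rmorphM rmorphXn/= rmorphN1 -pmulrn !exprMn -!exprM.
by case: s; rewrite ?expr0 ?mul0n ?mul1n ?expr0 ?mul1r//
  sqrrN expr1n (exprM _ 2 2) sqrrN !expr1n !mul1r.
Qed.

(** Compare squares with q = m^2: (q + 1/2)^2 exceeds q^2 + q by 1/4, and lowering q + 1/2 by 1/(4q)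
    reverses the inequality. *)
Lemma boussinesq_defect_bounds (m : nat) : (0 < m)%N ->
  2^-1 - (4 * m%:R ^+ 2)^-1 <= boussinesq_defect m <= 2^-1.
Proof.
move=> m0; rewrite /boussinesq_defect /boussinesq -pmulrn.
have m1 : 1 <= m%:R ^+ 2 :> R by rewrite -natrX ler1n expn_gt0 m0.
rewrite (exprM _ 2 2); set q : R := m%:R ^+ 2 in m1 *.
have q0 : 0 < q by rewrite (lt_le_trans _ m1).
have s0 := sqrtr_ge0 (q + q ^+ 2).
have s2 : Num.sqrt (q + q ^+ 2) ^+ 2 = q + q ^+ 2.
  by rewrite sqr_sqrtr// addr_ge0 ?sqr_ge0// ltW.
set d := (4 * q)^-1.
have dq : d * q = 4^-1 by rewrite /d; field; rewrite gt_eqF.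
have d0 : 0 < d by rewrite invr_gt0; lra.
have d4 : d <= 4^-1 by nra.
rewrite lerBrDr lerBlDr; apply/andP; split.
  have p : 0 <= 2^-1 - d + q by lra.
  by rewrite -(@ler_pXn2r _ 2) ?nnegrE// s2; nra.
have p : 0 <= 2^-1 + q by lra.
by rewrite -(@ler_pXn2r _ 2) ?nnegrE// s2; nra.
Qed.

(** Cruder than what the two-sided bounds give, but enough: over the 2^j indices from 2^j on, the
    steps add up to at most 1. *)
Lemma boussinesq_defect_variation (m : nat) : (0 < m)%N ->
  `|boussinesq_defect m.+1 - boussinesq_defect m| <= m%:R^-1.
Proof.
move=> m0; have /andP[a1 a2] := boussinesq_defect_bounds m0.
have /andP[b1 b2] := @boussinesq_defect_bounds m.+1 isT.
have mR : 0 < m%:R :> R by rewrite ltr0n.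
have h (k : nat) : (m <= k)%N -> (4 * k%:R ^+ 2)^-1 <= m%:R^-1 :> R.
  move=> mk; have kR : m%:R <= k%:R :> R by rewrite ler_nat.
  have m1 : 1 <= m%:R :> R by rewrite ler1n.
  rewrite lef_pV2 ?posrE// ?mulr_gt0// ?exprn_gt0// ?(lt_le_trans mR)//.
  by rewrite expr2; nra.
move: (h _ (leqnn m)) (h _ (leqnSn m)) a1 b1.
set u := (4 * _)^-1; set v := (4 * _)^-1 => hu hv a1 b1.
by rewrite ler_norml; apply/andP; split; lra.
Qed.

(** Translating the block to 0 turns t(2^j + k)^2 into t k^2 plus a term linear in k, so a Weyl sum
    at another point appears. Amplitude and defect vary slowly: [A] pays for the last value, A|t|
    for the defect, [V] for the amplitude. *)
Lemma block_phase_bound t rho C (j K : nat) (s : bool) (a : nat -> R[i]) A V y :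
  0 <= C -> 0 <= rho -> 0 <= A -> 0 <= V ->
  weyl_bound t rho C -> (K <= 2 ^ j)%N ->
  (forall k, (k < K)%N -> normc (a k) <= A) ->
  (forall k, (k.+1 < K)%N -> normc (a k.+1 - a k) <= V / 2 ^+ j) ->
  normc (\sum_(k < K) a k *
    (let n : int := (-1) ^+ s * (2 ^ j + k)%N%:Z in
     cexp (t * boussinesq R n + n%:~R * y))) <=
  C * rho ^+ j * (A * (1 + `|t|) + V).
Proof.
move=> C0 rho0 A0 V0 wb Kj aA aV.
have B0 : 0 <= C * rho ^+ j by rewrite mulr_ge0// exprn_ge0.
case: K Kj aA aV => [|K] Kj aA aV.
  by rewrite big_ord0 normc0 mulr_ge0// addr_ge0// mulr_ge0// addr_ge0.
pose M : R := (2 ^ j)%:R.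
pose sg : R := (-1) ^+ s.
pose z (k : nat) : R[i] := cexp (t * M ^+ 2 + sg * M * y) *
   cexp (t * k%:R ^+ 2 + k%:R * (2 * t * M + sg * y)).
pose c (k : nat) : R[i] := a k * cexp (t * boussinesq_defect (2 ^ j + k)).
rewrite (eq_bigr (fun k : 'I_K.+1 => c k * z k)); last first.
  move=> k _ /=; rewrite boussinesqE /c /z -mulrA; congr (_ * _).
  rewrite -!cexpD; congr cexp.
  by rewrite rmorphM rmorphXn/= rmorphN1 -/sg -pmulrn natrD -/M; ring.
rewrite (le_trans (@abel_sum_bound R c z K (C * rho ^+ j) _))//.
  move=> m mK; rewrite -mulr_sumr normcM normc_cexp mul1r.
  by apply: wb; rewrite (leq_trans mK).
rewrite ler_wpM2l// mulrDr mulr1 -addrA lerD//.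
  by rewrite /c normcM normc_cexp mulr1 aA.
have M0 : 0 < M by rewrite ltr0n expn_gt0.
have step k : (k < K)%N -> normc (c k.+1 - c k) <= (A * `|t| + V) / M.
  move=> kK.
  have -> : c k.+1 - c k =
    a k.+1 * (cexp (t * boussinesq_defect (2 ^ j + k.+1)) -
      cexp (t * boussinesq_defect (2 ^ j + k))) +
    (a k.+1 - a k) * cexp (t * boussinesq_defect (2 ^ j + k)) by rewrite /c; ring.
  rewrite (le_trans (normcD _ _))// [leRHS]mulrDl !normcM normc_cexp mulr1.
  rewrite lerD//; last by rewrite /M natrX; exact: aV.
  rewrite -mulrA ler_pM ?normc_ge0 ?aA// (le_trans (normc_cexpB _ _))//.
  rewrite -mulrBr normrM ler_wpM2l// addnS.
  rewrite (le_trans (boussinesq_defect_variation _))// ?addn_gt0 ?expn_gt0//.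
  by rewrite lef_pV2 ?posrE ?ltr0n ?addn_gt0 ?expn_gt0// ler_nat leq_addr.
apply: (@le_trans _ _ (\sum_(k < K) (A * `|t| + V) / M)).
  by apply: ler_sum => k _; exact: step.
rewrite sumr_const card_ord -mulr_natr mulrAC ler_pdivrMr//.
rewrite ler_wpM2l// ?addr_ge0 ?mulr_ge0// ler_nat.
exact: ltnW.
Qed.

End BlockBounds.

Section EvolutionBlocks.
Variable R : realType.
Variable g : R -> R[i].
Hypothesis gBV : BV_torus g.
Implicit Types (t x y rho C : R).

Definition evolution_term t (n : int) x : R[i] :=
  fourier g n * cexp (t * boussinesq R n + n%:~R * x).

Definition evolution_pair t (m : nat) x : R[i] :=
  evolution_term t m%:Z x + evolution_term t (- m%:Z) x.

Lemma normc_frequency_inv (s : bool) (m : nat) :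
  normc ((((-1) ^+ s * m%:Z)%:~R^-1 : R)%:C) = m%:R^-1.
Proof.
rewrite normc_real normfV rmorphM rmorphXn/= rmorphN1 normrM normrX normrN1.
by rewrite expr1n mul1r -pmulrn normr_nat.
Qed.

Lemma frequency_step (s : bool) (m : nat) :
  ((-1) ^+ s * m.+1%:Z)%:~R = ((-1) ^+ s * m%:Z)%:~R + (-1) ^+ s :> R.
Proof. by rewrite -addn1 PoszD mulrDr mulr1 rmorphD/= rmorphXn/= rmorphN1. Qed.

(** One estimate, [oneside], serves for two weights. For w = 1 the 1/n of the integration by parts
    gives the decay (rho/2)^j; for w = exp(inh) - 1, of size at most |nh|, it is cancelled and |h|
    rho^j remains. *)
Lemma evolution_block_bound t rho C : 0 <= C -> 0 <= rho ->
  weyl_bound t rho C ->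
  exists2 D : R, 0 <= D & forall (j K : nat), (K <= 2 ^ j)%N ->
    (forall x, normc (\sum_(k < K) evolution_pair t (2 ^ j + k) x) <=
      D * (rho / 2) ^+ j) /\
    (forall x h, normc (\sum_(k < K) (evolution_pair t (2 ^ j + k) (x + h) -
      evolution_pair t (2 ^ j + k) x)) <= D * `|h| * rho ^+ j).
Proof.
move=> C0 rho0 wb; have [V V0 HV] := fourier_sum_bound gBV.
have D0 : 0 <= V * C * (3 + `|t|) * 2.
  by rewrite !mulr_ge0// addr_ge0.
(* 3 + |t| covers 1 + |t| plus the variation of the amplitude, which is at most twice its size; the
   last 2 counts the two signs of the frequency. *)
exists (V * C * (3 + `|t|) * 2) => // j K Kj.
pose n (s : bool) (k : nat) : int := (-1) ^+ s * (2 ^ j + k)%N%:Z.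
have n0 s k : (k < K)%N -> n s k != 0.
  by move=> _; rewrite mulf_neq0// ?signr_eq0// eqz_nat -lt0n addn_gt0 expn_gt0.
have inv_le k : (2 ^ j + k)%N%:R^-1 <= (2 ^+ j)^-1 :> R.
  rewrite -natrX lef_pV2 ?posrE ?ltr0n ?addn_gt0 ?expn_gt0//.
  by rewrite ler_nat leq_addr.
have sgE s : `|(-1) ^+ s| = 1 :> R by rewrite normrX normrN1 expr1n.
have pairE (m : nat) x : evolution_pair t m x =
    evolution_term t ((-1) ^+ false * m%:Z) x +
    evolution_term t ((-1) ^+ true * m%:Z) x.
  by rewrite /evolution_pair expr0 expr1 mul1r mulN1r.
have rB (a b : R) : a%:C - b%:C = (a - b)%:C :> R[i] by rewrite rmorphB.
have inv_step s k : normc (((n s k.+1)%:~R^-1 - (n s k)%:~R^-1 : R)%:C) =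
    ((2 ^ j + k)%:R * (2 ^ j + k.+1)%:R)^-1.
  rewrite normc_real /n addnS frequency_step.
  have -> : ((-1) ^+ s * (2 ^ j + k)%:Z)%:~R = (-1) ^+ s * (2 ^ j + k)%:R :> R.
    by rewrite rmorphM rmorphXn/= rmorphN1 -pmulrn.
  have M0 : 0 < (2 ^ j + k)%:R :> R by rewrite ltr0n addn_gt0 expn_gt0.
  rewrite -natr1; set M := (2 ^ j + k)%:R.
  have -> : ((-1) ^+ s * M + (-1) ^+ s)^-1 - ((-1) ^+ s * M)^-1 =
      - ((-1) ^+ s * (M * (M + 1))^-1) :> R.
    rewrite -[X in (_ + X)^-1]mulr1 -mulrDr !invr_signM -mulrBr -mulrN.
    congr (_ * _); field.
    by rewrite !gt_eqF//; lra.
  by rewrite normrN normrM sgE mul1r gtr0_norm// invr_gt0 mulr_gt0// ltr_wpDr.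
have oneside s (w : nat -> R[i]) x A W : 0 <= A -> 0 <= W ->
    (forall k, (k < K)%N -> normc (((n s k)%:~R^-1)%:C * w k) <= A) ->
    (forall k, (k.+1 < K)%N -> normc (((n s k.+1)%:~R^-1)%:C * w k.+1 -
       ((n s k)%:~R^-1)%:C * w k) <= W / 2 ^+ j) ->
    normc (\sum_(k < K) (cexp (t * boussinesq R (n s k) + (n s k)%:~R * x) * w k) *
      fourier g (n s k)) <= V * (C * rho ^+ j * (A * (1 + `|t|) + W)).
  move=> A0 W0 hA hW.
  apply: (HV K (n s) (fun k => cexp (t * boussinesq R (n s k) + (n s k)%:~R * x) * w k)).
    exact: n0.
  move=> y.
  have := @block_phase_bound R t rho C j K s (fun k => ((n s k)%:~R^-1)%:C * w k)
    A W (x - y) C0 rho0 A0 W0 wb Kj hA hW.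
  apply: le_trans; rewrite le_eqVlt; apply/orP; left; apply/eqP; congr normc.
  apply: eq_bigr => k _ /=; rewrite -/(n s k).
  rewrite mulrBr addrA [in RHS]cexpD; ring.
have i2 : 0 <= (2 ^+ j)^-1 :> R by rewrite invr_ge0 exprn_ge0.
have r2 : 0 <= rho ^+ j by rewrite exprn_ge0.
split.
  move=> x.
  have H s : normc (\sum_(k < K) evolution_term t (n s k) x) <=
      V * (C * rho ^+ j * ((2 ^+ j)^-1 * (1 + `|t|) + (2 ^+ j)^-1)).
    have := oneside s (fun=> 1) x (2 ^+ j)^-1 (2 ^+ j)^-1 i2 i2.
    under eq_bigr do rewrite mulr1 mulrC.
    apply=> k kK; rewrite !mulr1.
      by rewrite normc_frequency_inv.
    rewrite rB inv_step invfM.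
    rewrite ler_pM ?invr_ge0// -invfM; exact: inv_le.
  have E : \sum_(k < K) evolution_pair t (2 ^ j + k) x =
     \sum_(k < K) evolution_term t (n false k) x +
     \sum_(k < K) evolution_term t (n true k) x.
    by rewrite -big_split/=; apply: eq_bigr => k _; rewrite pairE.
  rewrite E (le_trans (normcD _ _))// (le_trans (lerD (H _) (H _)))//.
  have -> : V * C * (3 + `|t|) * 2 * (rho / 2) ^+ j =
     V * C * (rho ^+ j * (2 ^+ j)^-1) * (3 + `|t|) * 2.
    by rewrite expr_div_n; ring.
  have p : 0 <= V * C * (rho ^+ j * (2 ^+ j)^-1) by rewrite !mulr_ge0.
  have := normr_ge0 t; move: p; set u := V * C * _.
  have -> : V * (C * rho ^+ j * ((2 ^+ j)^-1 * (1 + `|t|) + (2 ^+ j)^-1)) = u * (2 + `|t|).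
    by rewrite /u; ring.
  move=> *; nra.
move=> x h.
have H s : normc (\sum_(k < K) (evolution_term t (n s k) (x + h) -
      evolution_term t (n s k) x)) <=
    V * (C * rho ^+ j * (`|h| * (1 + `|t|) + 2 * `|h|)).
  have wle k : normc (cexp ((n s k)%:~R * h) - 1) <= (2 ^ j + k)%:R * `|h|.
    rewrite -cexp0 (le_trans (normc_cexpB _ _))// subr0 normrM.
    by rewrite rmorphM rmorphXn/= rmorphN1 normrM sgE mul1r -pmulrn normr_nat.
  have := oneside s (fun k => cexp ((n s k)%:~R * h) - 1) x `|h| (2 * `|h|).
  rewrite (eq_bigr (fun k : 'I_K => evolution_term t (n s k) (x + h) -
      evolution_term t (n s k) x)); last first.
    move=> k _; rewrite /evolution_term [_ * (x + h)]mulrDr addrA.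
    by rewrite [in RHS]cexpD; ring.
  have M0 k : 0 < (2 ^ j + k)%:R :> R by rewrite ltr0n addn_gt0 expn_gt0.
  apply=> // k kK.
    rewrite normcM normc_frequency_inv mulrC ler_pdivrMr//.
    by rewrite [leRHS]mulrC wle.
  have -> : ((n s k.+1)%:~R^-1)%:C * (cexp ((n s k.+1)%:~R * h) - 1) -
      ((n s k)%:~R^-1)%:C * (cexp ((n s k)%:~R * h) - 1) =
      ((n s k.+1)%:~R^-1)%:C * (cexp ((n s k.+1)%:~R * h) - cexp ((n s k)%:~R * h)) +
      ((n s k.+1)%:~R^-1 - (n s k)%:~R^-1)%:C * (cexp ((n s k)%:~R * h) - 1) :> R[i].
    by rewrite -rB; ring.
  rewrite (le_trans (normcD _ _))// !normcM inv_step normc_frequency_inv.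
  have le2 : (2 ^ j + k.+1)%:R^-1 * `|h| <= (2 ^+ j)^-1 * `|h| by rewrite ler_wpM2r.
  have -> : 2 * `|h| / 2 ^+ j = (2 ^+ j)^-1 * `|h| + (2 ^+ j)^-1 * `|h| by ring.
  rewrite lerD// (le_trans _ le2)//.
    rewrite ler_wpM2l ?invr_ge0// (le_trans (normc_cexpB _ _))//.
    rewrite -mulrBl /n addnS frequency_step addrAC subrr add0r normrM sgE mul1r.
    exact: lexx.
  rewrite (le_trans (ler_wpM2l _ (wle k)))// ?invr_ge0 ?mulr_ge0//.
  by rewrite invfM mulrAC mulrA mulVf ?gt_eqF// mul1r mulrC.
have E : \sum_(k < K) (evolution_pair t (2 ^ j + k) (x + h) -
      evolution_pair t (2 ^ j + k) x) =
   \sum_(k < K) (evolution_term t (n false k) (x + h) - evolution_term t (n false k) x) +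
   \sum_(k < K) (evolution_term t (n true k) (x + h) - evolution_term t (n true k) x).
  by rewrite -big_split/=; apply: eq_bigr => k _; rewrite !pairE /n; ring.
rewrite E (le_trans (normcD _ _))// (le_trans (lerD (H _) (H _)))//.
rewrite le_eqVlt; apply/orP; left; apply/eqP; ring.
Qed.
End EvolutionBlocks.

Section DyadicLimits.
Variable R : realType.
Implicit Types (x h q rho D : R).

Lemma geometric_limit_real (a : nat -> R) D q : 0 <= D -> 0 < q < 1 ->
  (forall j, `|a j.+1 - a j| <= D * q ^+ j) ->
  exists l, forall j, `|a j - l| <= D * q ^+ j / (1 - q).
Proof.
move=> D0 /andP[q0 q1] aD.
have d0 : 0 < 1 - q by rewrite subr_gt0.
pose e j := D * q ^+ j / (1 - q).
have eS j : e j = e j.+1 + D * q ^+ j.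
  by rewrite /e exprS; field; rewrite gt_eqF.
have e0 j : 0 <= e j by rewrite divr_ge0 ?mulr_ge0 ?exprn_ge0// ltW.
have lo j m : a j - e j <= a (j + m)%N - e (j + m)%N.
  elim: m => [|m IH]; first by rewrite addn0.
  rewrite (le_trans IH)// addnS (eS (j + m)%N).
  by have := aD (j + m)%N; rewrite ler_norml; lra.
have hi j m : a (j + m)%N + e (j + m)%N <= a j + e j.
  elim: m => [|m IH]; first by rewrite addn0.
  rewrite (le_trans _ IH)// addnS (eS (j + m)%N).
  by have := aD (j + m)%N; rewrite ler_norml; lra.
have lohi j m : a j - e j <= a m + e m.
  have := lo j m; have := hi m j; rewrite addnC.
  have := e0 (j + m)%N; lra.
(* The intervals of centre [a j] and radius [e j] are nested, so every left end lies below every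
   right end and the supremum of the left ends belongs to all of them. *)
pose l := sup (range (fun j => a j - e j)).
exists l => j; rewrite ler_distlC; apply/andP; split.
- apply: ub_le_sup; last by exists j.
  by exists (a 0%N + e 0%N) => _ [m _ <-].
- apply: ge_sup; first by exists (a 0%N - e 0%N); exists 0%N.
  by move=> _ [m _ <-].
Qed.

Lemma geometric_limit (a : nat -> R[i]) D q : 0 <= D -> 0 < q < 1 ->
  (forall j, normc (a j.+1 - a j) <= D * q ^+ j) ->
  exists l, forall j, normc (a j - l) <= 2 * (D * q ^+ j / (1 - q)).
Proof.
move=> D0 q01 aD.
have [l1 H1] : exists l, forall j, `|complex.Re (a j) - l| <= D * q ^+ j / (1 - q).
  apply: geometric_limit_real => // j.
  by rewrite -ReB (le_trans (normr_Re_le _)).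
have [l2 H2] : exists l, forall j, `|complex.Im (a j) - l| <= D * q ^+ j / (1 - q).
  apply: geometric_limit_real => // j.
  by rewrite -ImB (le_trans (normr_Im_le _)).
exists (l1 +i* l2) => j; rewrite (le_trans (normc_le_ReIm _))//.
by rewrite ReB ImB/= mulr_natl mulr2n lerD.
Qed.

Variable T : nat -> R -> R[i].
Definition dyadic_partial (n : nat) x : R[i] := \sum_(1 <= m < n) T m x.

Lemma dyadic_partialD (j K : nat) x :
  dyadic_partial (2 ^ j + K) x =
  dyadic_partial (2 ^ j) x + \sum_(k < K) T (2 ^ j + k)%N x.
Proof.
rewrite /dyadic_partial (@big_cat_nat _ _ _ (2 ^ j)) ?expn_gt0 ?leq_addr//=.
congr (_ + _); rewrite -{1}[(2 ^ j)%N]add0n big_addn addnC addnK big_mkord.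
by apply: eq_bigr => k _; rewrite addnC.
Qed.

(** For |h| <= 2^-J the blocks below [J] are estimated through their increments, a sum dominated by
    its last term because rho > 1, and the tail through its sup norm, summable because rho < 2. The
    two estimates meet at (rho/2)^J. *)
Lemma dyadic_limit D rho : 0 <= D -> 1 < rho < 2 ->
  (forall (j K : nat), (K <= 2 ^ j)%N ->
    (forall x, normc (\sum_(k < K) T (2 ^ j + k)%N x) <= D * (rho / 2) ^+ j) /\
    (forall x h, normc (\sum_(k < K) (T (2 ^ j + k)%N (x + h) - T (2 ^ j + k)%N x))
      <= D * `|h| * rho ^+ j)) ->
  exists (v : R -> R[i]) (E : R), [/\ 0 <= E,
    forall j n x, (2 ^ j <= n <= 2 ^ j.+1)%N ->
      normc (dyadic_partial n x - v x) <= E * (rho / 2) ^+ j &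
    forall J x h, `|h| <= (2 ^+ J)^-1 ->
      normc (v (x + h) - v x) <= E * (rho / 2) ^+ J].
Proof.
move=> D0 /andP[rho1 rho2] HB.
set q := rho / 2 in HB *.
have q0 : 0 < q by rewrite /q; lra.
have q1 : q < 1 by rewrite /q; lra.
have d0 : 0 < 1 - q by rewrite subr_gt0.
have qj j : 0 <= q ^+ j by rewrite exprn_ge0// ltW.
pose U j x := dyadic_partial (2 ^ j) x.
have US j x : U j.+1 x = U j x + \sum_(k < 2 ^ j) T (2 ^ j + k)%N x.
  by rewrite /U expnS mul2n -addnn dyadic_partialD.
have UD x j : normc (U j.+1 x - U j x) <= D * q ^+ j.
  by rewrite US addrC addKr; exact: (HB j (2 ^ j)%N (leqnn _)).1.
have q01 : 0 < q < 1 by rewrite q0.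
have [v Hv] := choice (fun x => geometric_limit D0 q01 (UD x)).
have EU0 : 0 <= 2 * D / (1 - q) by rewrite divr_ge0 ?mulr_ge0// ltW.
have Hv' x j : normc (U j x - v x) <= 2 * D / (1 - q) * q ^+ j.
  by rewrite (le_trans (Hv x j))// le_eqVlt; apply/orP; left; apply/eqP; ring.
have E10 : 0 <= D / (rho - 1) by rewrite divr_ge0// subr_ge0 ltW.
(* [D] is for an incomplete block, 4D/(1-q) for the two tails at x and x + h, D/(rho-1) for the
   increments of the low blocks. *)
pose E := D + 4 * D / (1 - q) + D / (rho - 1).
have E0 : 0 <= E by rewrite !addr_ge0// divr_ge0 ?mulr_ge0// ltW.
exists v, E; split => //.
- move=> j n x /andP[jn nj].
  rewrite -(subnKC jn) dyadic_partialD -/(U j x).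
  have /HB[/(_ x) B _] : (n - 2 ^ j <= 2 ^ j)%N.
    by rewrite leq_subLR addnn -mul2n -expnS.
  rewrite addrAC (le_trans (normcD _ _))// (le_trans (lerD (Hv' x j) B))//.
  rewrite -mulrDl ler_wpM2r// /E.
  have -> : 4 * D / (1 - q) = 2 * D / (1 - q) + 2 * D / (1 - q) by ring.
  lra.
- move=> J x h hJ.
  have UJ : normc (U J (x + h) - U J x) <= D * `|h| * (rho ^+ J / (rho - 1)).
    elim: (J) => [|j IH].
      rewrite /U /dyadic_partial expn0 !big_geq// subrr normc0.
      by rewrite expr0 !mulr_ge0// invr_ge0 subr_ge0 ltW.
    have -> : U j.+1 (x + h) - U j.+1 x = (U j (x + h) - U j x) +
        \sum_(k < 2 ^ j) (T (2 ^ j + k)%N (x + h) - T (2 ^ j + k)%N x).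
      by rewrite !US sumrB; ring.
    rewrite (le_trans (normcD _ _))//.
    have /(_ x h) B := (HB j (2 ^ j)%N (leqnn _)).2.
    rewrite (le_trans (lerD IH B))// le_eqVlt; apply/orP; left; apply/eqP.
    by rewrite exprS; field; rewrite subr_eq0 gt_eqF.
  have -> : v (x + h) - v x = (U J (x + h) - U J x) -
      (U J (x + h) - v (x + h)) + (U J x - v x) by ring.
  rewrite (le_trans (normcD _ _))// (le_trans (lerD (normcB _ _) (lexx _)))//.
  rewrite (le_trans (lerD (lerD UJ (Hv' _ _)) (Hv' _ _)))//.
  have hq : `|h| * rho ^+ J <= q ^+ J.
    rewrite /q expr_div_n [leRHS]mulrC ler_wpM2r// exprn_ge0//.
    by rewrite (le_trans _ (ltW rho1)).
  have Dh : D * `|h| * (rho ^+ J / (rho - 1)) <= D / (rho - 1) * q ^+ J.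
    have -> : D * `|h| * (rho ^+ J / (rho - 1)) = D / (rho - 1) * (`|h| * rho ^+ J).
      by ring.
    by rewrite ler_wpM2l.
  rewrite (le_trans (lerD (lerD Dh (lexx _)) (lexx _)))//.
  rewrite -!mulrDl ler_wpM2r// /E.
  have -> : 4 * D / (1 - q) = 2 * D / (1 - q) + 2 * D / (1 - q) by ring.
  lra.
Qed.

End DyadicLimits.

(** * The evolution as a uniform limit of symmetric partial sums *)

Lemma sum_symmetric (V : zmodType) (F : int -> V) N :
  \sum_(k < N.*2.+1) F (k%:Z - N%:Z) =
  F 0 + \sum_(1 <= m < N.+1) (F m%:Z + F (- m%:Z)).
Proof.
rewrite -(big_mkord xpredT (fun k : nat => F (k%:Z - N%:Z))).
rewrite (@big_cat_nat _ _ _ N)//=; last by lia.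
rewrite (@big_nat_recl _ _ _ (N.*2)) //=; last by lia.
rewrite subrr addrCA; congr (_ + _).
have E3 (G : nat -> V) :
    \sum_(N <= i < N.*2) G i = \sum_(0 <= i < N) G (i + N)%N.
  by rewrite -{1}[N]add0n big_addn -addnn addnK.
rewrite E3 big_nat_rev/=.
rewrite big_add1/= big_split/= addrC; congr (_ + _).
  by apply: eq_bigr => i _; congr F; lia.
by apply: eq_big_nat => i /andP[_ iN]; congr F; lia.
Qed.

Section ContinuousEvolution.
Variable R : realType.
Variable g : R -> R[i].
Hypothesis gBV : BV_torus g.
Variable t : R.
Implicit Types (x y h e rho C : R) (u : R -> R[i]).

Notation mu := (@lebesgue_measure R).
Notation S := (evolution_partial (@boussinesq R) g t).

Lemma evolution_partialE N x :
  S N x = evolution_term g t 0 x + dyadic_partial (evolution_pair g t) N.+1 x.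
Proof. exact: (sum_symmetric (fun n => evolution_term g t n x) N). Qed.

Lemma exp_small q E e : 0 < q < 1 -> 0 <= E -> 0 < e ->
  exists J : nat, forall j, (J <= j)%N -> E * q ^+ j <= e.
Proof.
move=> q01 E0 e0; have /andP[q0 q1] := q01.
have d0 : 0 < 1 - q by rewrite subr_gt0.
exists (Num.bound (E / (1 - q) / e)) => j Jj.
have jR : 0 < j.+1%:R :> R by rewrite ltr0n.
have lt : E / (1 - q) / e < j.+1%:R.
  rewrite (@lt_le_trans _ _ (Num.bound (E / (1 - q) / e))%:R)//.
    by rewrite archi_boundP// !divr_ge0// ltW.
  by rewrite ler_nat ltnW.
have := nat_geometric_bound j q01; rewrite -ler_pdivlMl// => qj.
rewrite (le_trans (ler_wpM2l E0 qj))//.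
have -> : E * (j.+1%:R^-1 * (1 - q)^-1) = E / (1 - q) / j.+1%:R by ring.
by rewrite ler_pdivrMr// [leRHS]mulrC -ler_pdivrMr// ltW.
Qed.

Lemma continuous_of_modulus (f : R -> R) :
  (forall e, 0 < e -> exists2 d, 0 < d &
    forall x h, `|h| <= d -> `|f (x + h) - f x| <= e) -> continuous f.
Proof.
move=> H x; apply/cvgrPdist_le => e e0; have [d d0 Hd] := H e e0.
have : \forall y \near x, `|x - y| < d by exact: nbhsx_ballx.
apply: filterS => y; rewrite [in X in X -> _]distrC => /ltW/Hd - /(_ x).
by rewrite subrKC distrC.
Qed.

Lemma evolution_partial_lipschitz N : exists2 L, 0 <= L &
  forall x h, normc (S N (x + h) - S N x) <= L * `|h|.
Proof.
pose n (k : nat) : int := k%:Z - N%:Z.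
exists (\sum_(k < N.*2.+1) normc (fourier g (n k)) * `|(n k)%:~R|).
  by apply: sumr_ge0 => k _; rewrite mulr_ge0// normc_ge0.
move=> x h; rewrite /evolution_partial -sumrB mulr_suml.
rewrite (le_trans (normc_sum _ _ _))// ler_sum// => k _.
rewrite -mulrBr normcM -mulrA ler_wpM2l ?normc_ge0//.
rewrite (le_trans (normc_cexpB _ _))// -/(n k).
have -> : t * boussinesq R (n k) + (n k)%:~R * (x + h) -
  (t * boussinesq R (n k) + (n k)%:~R * x) = (n k)%:~R * h by ring.
by rewrite normrM.
Qed.

Lemma evolution_partial_periodic N x : S N (x + pi *+ 2) = S N x.
Proof.
apply: eq_bigr => k _ /=; congr (_ * _).
by rewrite mulrDr addrA cexpD cexp2piz mulr1.
Qed.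

(** A notion free of the rate [rho]: limits obtained at different rates are limits of the same
    partial sums, hence equal. *)
Definition uniform_evolution u := forall e, 0 < e -> exists N0 : nat,
  forall N x, (N0 <= N)%N -> normc (S N x - u x) <= e.

Lemma uniform_evolution_unique u1 u2 :
  uniform_evolution u1 -> uniform_evolution u2 -> u1 = u2.
Proof.
move=> H1 H2; apply/funext => x; apply/eqP; rewrite -subr_eq0; apply/eqP.
apply: eq0_normc; apply/eqP; rewrite eq_le normc_ge0 andbT.
apply/ler_addgt0Pr => e e0; rewrite add0r.
have e20 : 0 < e / 2 by rewrite divr_gt0.
have [N1 HN1] := H1 _ e20; have [N2 HN2] := H2 _ e20.
have := HN1 (maxn N1 N2) x (leq_maxl _ _).
have := HN2 (maxn N1 N2) x (leq_maxr _ _).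
rewrite -[u1 x - u2 x](subrKA (S (maxn N1 N2) x)).
have := normcD (u1 x - S (maxn N1 N2) x) (S (maxn N1 N2) x - u2 x).
rewrite (normc_distC (u1 x)); lra.
Qed.

Lemma uniform_evolution_periodic u : uniform_evolution u -> torus_fun u.
Proof.
move=> H x; rewrite -[LHS]/((fun x => u (x + pi *+ 2)) x).
rewrite (@uniform_evolution_unique (fun x => u (x + pi *+ 2)) u)//.
move=> e /H[N0 HN]; exists N0 => N y NN.
by rewrite -evolution_partial_periodic HN.
Qed.

Lemma uniform_evolution_holder rho C : 0 <= C -> 1 < rho < 2 ->
  weyl_bound t rho C ->
  exists u E, [/\ 0 <= E, uniform_evolution u &
    forall J x h, `|h| <= (2 ^+ J)^-1 ->
      normc (u (x + h) - u x) <= E * (rho / 2) ^+ J].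
Proof.
move=> C0 /andP[rho1 rho2] wb.
have rho0 : 0 <= rho by rewrite (le_trans _ (ltW rho1)).
have [D D0 HD] := evolution_block_bound gBV C0 rho0 wb.
have rho12 : 1 < rho < 2 by rewrite rho1.
have [v [E [E0 Ev Hv]]] := dyadic_limit D0 rho12 HD.
have t0 x y : evolution_term g t 0 x = evolution_term g t 0 y.
  by rewrite /evolution_term !mul0r.
(* Frequency 0 lies outside the dyadic blocks; its term does not depend on [x] and leaves the
   increments unchanged. *)
exists (fun x => evolution_term g t 0 x + v x), E; split => //; last first.
  by move=> J x h hJ; rewrite (t0 (x + h) x) opprD addrACA subrr add0r Hv.
move=> e e0; have q01 : 0 < rho / 2 < 1 by lra.
have [J HJ] := exp_small q01 E0 e0.
exists (2 ^ J)%N => N x JN; rewrite evolution_partialE opprD addrACA subrr add0r.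
have N1 : (0 < N.+1)%N by [].
have /andP[l1 l2] := trunc_log_bounds (isT : 1 < 2)%N N1.
rewrite (le_trans (Ev (trunc_log 2 N.+1) _ _ _))//; first by rewrite l1 ltnW.
by rewrite HJ// trunc_log_max// ltnW.
Qed.

End ContinuousEvolution.

Section ContinuousEvolutionL2.
Variable R : realType.
Variable g : R -> R[i].
Hypothesis gBV : BV_torus g.
Variable t : R.
Implicit Types (x y h e rho C : R) (u : R -> R[i]).

Notation mu := (@lebesgue_measure R).
Notation S := (evolution_partial (@boussinesq R) g t).

Definition uniform_modulus u := forall e, 0 < e -> exists2 d, 0 < d &
  forall x h, `|h| <= d -> normc (u (x + h) - u x) <= e.

Lemma uniform_modulus_Re u : uniform_modulus u ->
  continuous (fun x => complex.Re (u x)).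
Proof.
move=> H; apply: continuous_of_modulus => e /H[d d0 Hd]; exists d => // x h hd.
by rewrite -ReB (le_trans (normr_Re_le _))// Hd.
Qed.

Lemma uniform_modulus_Im u : uniform_modulus u ->
  continuous (fun x => complex.Im (u x)).
Proof.
move=> H; apply: continuous_of_modulus => e /H[d d0 Hd]; exists d => // x h hd.
by rewrite -ImB (le_trans (normr_Im_le _))// Hd.
Qed.

Lemma evolution_partial_modulus N : uniform_modulus (S N).
Proof.
move=> e e0; have [L L0 HL] := evolution_partial_lipschitz g t N.
exists (e / (L + 1)); first by rewrite divr_gt0// ltr_wpDl.
move=> x h; rewrite ler_pdivlMr ?ltr_wpDl// => hd.
rewrite (le_trans (HL x h))// (le_trans _ hd)// mulrC ler_wpM2l//.
by rewrite lerDl.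
Qed.

Lemma holder_modulus u E rho : 0 <= E -> 0 < rho < 2 ->
  (forall J x h, `|h| <= (2 ^+ J)^-1 ->
    normc (u (x + h) - u x) <= E * (rho / 2) ^+ J) -> uniform_modulus u.
Proof.
move=> E0 rho02 H e e0; have q01 : 0 < rho / 2 < 1 by lra.
have [J HJ] := exp_small q01 E0 e0.
exists (2 ^+ J)^-1; first by rewrite invr_gt0 exprn_gt0.
by move=> x h hJ; rewrite (le_trans (H _ _ _ hJ))// HJ.
Qed.

Lemma uniform_evolution_continuous u : uniform_modulus u ->
  uniform_evolution g t u -> continuous_evolution (@boussinesq R) g t u.
Proof.
move=> mu_u ue; split.
- exact: uniform_evolution_periodic ue.
- exact: uniform_modulus_Re.
- exact: uniform_modulus_Im.
have P0 : 0 < pi *+ 2 :> R by rewrite mulrn_wgt0// pi_gt0.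
pose f N x := sqnorm (S N x - u x).
have mf N : measurable_fun `[0, pi *+ 2] (EFin \o f N).
  apply/measurable_EFinP.
  have cm (h : R -> R) : continuous h -> measurable_fun `[0, pi *+ 2] h.
    by move=> ch; apply: measurable_funTS; exact: continuous_measurable_fun.
  have -> : f N = (fun x => (complex.Re (S N x) - complex.Re (u x)) ^+ 2 +
      (complex.Im (S N x) - complex.Im (u x)) ^+ 2).
    by apply/funext => x; rewrite /f /sqnorm ReB ImB.
  apply: measurable_funD; apply: measurable_funX; apply: measurable_funB; apply: cm.
  - exact: uniform_modulus_Re (@evolution_partial_modulus N).
  - exact: uniform_modulus_Re.
  - exact: uniform_modulus_Im (@evolution_partial_modulus N).
  - exact: uniform_modulus_Im.
have f0 N x : 0 <= f N x by rewrite /f sqnormE sqr_ge0.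
pose I N := (\int[mu]_(x in `[0%R, (pi *+ 2)%R]) (f N x)%:E)%E.
have I0 N : (0 <= I N)%E by apply: integral_ge0 => x _; rewrite lee_fin.
have Ile e : 0 < e -> exists N0 : nat, forall N, (N0 <= N)%N ->
    (I N <= (e ^+ 2 * (pi *+ 2))%:E)%E.
  move=> e0; have [N0 HN] := ue e e0; exists N0 => N NN.
  apply: (@le_trans _ _ (\int[mu]_(x in `[0%R, (pi *+ 2)%R]) (e ^+ 2)%:E)%E).
    apply: ge0_le_integral => //.
    - by move=> x _; rewrite lee_fin.
    - exact: mf.
    move=> x _; rewrite lee_fin /f sqnormE.
    apply: lerXn2r; rewrite ?nnegrE ?normc_ge0 ?(ltW e0)//.
    exact: HN.
  rewrite integral_cst//= lebesgue_measure_itv/= lte_fin P0 oppr0 adde0.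
  by rewrite EFinM.
have e1 e : 0 < e -> exists N0 : nat, forall N, (N0 <= N)%N -> (I N <= e%:E)%E.
  move=> e0.
  have s0 : 0 < Num.sqrt (e / (pi *+ 2)) by rewrite sqrtr_gt0 divr_gt0.
  have [N0 HN] := Ile _ s0; exists N0 => N /HN.
  by rewrite sqr_sqrtr ?divr_ge0 ?(ltW e0) ?(ltW P0)// divfK// gt_eqF.
have fn e N : (I N <= e%:E)%E -> I N \is a fin_num.
  by move=> Ie; rewrite ge0_fin_numE; [rewrite (le_lt_trans Ie)// ltry|exact: I0].
apply/fine_cvgP; split.
  have [N0 HN] := e1 1 ltr01.
  by exists N0 => // N /= NN; exact: (fn 1 N (HN N NN)).
apply/cvgrPdist_le => e e0; have [N0 HN] := e1 e e0.
exists N0 => // N /= NN; rewrite sub0r normrN ger0_norm; last first.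
  by apply: fine_ge0; exact: I0.
by rewrite -lee_fin (fineK (fn e N (HN N NN))); exact: HN.
Qed.

End ContinuousEvolutionL2.

(** * Upper bound for the dimension *)

Section UpperDimension.
Variable R : realType.
Implicit Types (E : set (R * R)) (e h b eta rho : R).

Lemma limf_esup_right_le (f : R -> R) b :
  (forall eta, 0 < eta -> exists2 e0, 0 < e0 &
    forall e, 0 < e < e0 -> f e <= b + eta) ->
  (limf_esup (fun e => (f e)%:E) (0 : R)^'+ <= b%:E)%E.
Proof.
move=> H; apply/lee_addgt0Pr => eta eta0; have [e0 e00 He] := H eta eta0.
rewrite limf_esupE; apply: (@le_trans _ _ (ereal_sup ((fun e => (f e)%:E) @` `]0, e0[))).
  apply: ereal_inf_lbound; exists `]0, e0[%classic => //.
  apply: filterS2 (nbhs_right_gt 0) (nbhs_right_lt e00) => e ep ee0.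
  by rewrite /= in_itv/= ep.
apply: ge_ereal_sup => _ [e /= + <-]; rewrite in_itv/= => /He.
by rewrite -EFinD lee_fin.
Qed.

Lemma limf_esup_right_lt (f : R -> R) b :
  (limf_esup (fun e => (f e)%:E) (0 : R)^'+ < b%:E)%E ->
  exists2 e0, 0 < e0 & forall e, 0 < e < e0 -> f e <= b.
Proof.
rewrite limf_esupE => /ereal_inf_lt[_ [V FV <-]] lt.
have [e0 /= e00 He] : \forall e \near 0^'+, V e by [].
exists e0 => // e /andP[ep ee0]; rewrite -lee_fin.
apply: le_trans (ltW lt); apply: ereal_sup_ubound; exists e => //.
by apply: He => //=; rewrite sub0r normrN gtr0_norm.
Qed.

Lemma covering_numberP E e n : coverable E e n ->
  coverable E e (covering_number E e) /\ (covering_number E e <= n)%N.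
Proof.
move=> En; have ex : exists n, `[< coverable E e n >] by exists n; apply/asboolP.
have [m /asboolP Em mmin] := ex_minnP ex.
rewrite /covering_number; case: xgetP => [k kE [Ek kmin]|/(_ m) []]; first by split; rewrite ?kmin.
by split => // k Ek; apply: mmin; apply/asboolP.
Qed.

(** Over a column of width [w] the graph stays in a strip of height 2A, which [k] squares of side
    [w] cover. The balls are centred at the lower left corners, and the diameter of a square is
    below 2w <= e. *)
Lemma graph_coverable (f : R -> R) (w A e : R) (m k : nat) : 0 < w ->
  w *+ 2 <= e -> pi *+ 2 < m%:R * w -> A *+ 2 < k%:R * w ->
  (forall x h, 0 <= h <= w -> `|f (x + h) - f x| <= A) ->
  coverable (graph_torus f) e (m * k).
Proof.
move=> w0 we mw kw fA.
have A0 : 0 <= A by rewrite (le_trans _ (fA 0 0 _))// lexx ltW.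
(* Column i and height j are coded by the single index i k + j. *)
pose c (i : 'I_(m * k)) : R * R :=
  ((i %/ k)%:R * w, f ((i %/ k)%:R * w) - A + (i %% k)%:R * w).
exists c => -[x y] /= [] xP yE.
move: xP yE; rewrite in_itv/= => /andP[x0 xP] yE.
have tr z : 0 <= z -> (Num.truncn (z / w))%:R * w <= z < (Num.truncn (z / w))%:R * w + w.
  move=> z0; have zw : 0 <= z / w by rewrite divr_ge0// ltW.
  have /andP[l1 l2] := truncn_itv zw.
  rewrite -ler_pdivlMr// l1/= -[X in _ < _ + X]mul1r -mulrDl -ltr_pdivrMr//.
  by rewrite natr1.
have /andP[i1 i2] := tr x x0; set i := Num.truncn (x / w) in i1 i2.
have := fA (i%:R * w) (x - i%:R * w); rewrite subr_ge0 i1 lerBlDl ltW//=.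
rewrite subrKC -yE => /(_ isT); rewrite ler_norml => /andP[y1 y2].
pose z := y - (f (i%:R * w) - A).
have z0 : 0 <= z by rewrite /z; lra.
have /andP[j1 j2] := tr z z0; set j := Num.truncn (z / w) in j1 j2.
have im : (i < m)%N.
  by rewrite -(ltr_nat R) -(ltr_pM2r w0) (le_lt_trans i1)// (le_lt_trans xP).
have jk : (j < k)%N.
  by rewrite -(ltr_nat R) -(ltr_pM2r w0) (le_lt_trans j1)// (le_lt_trans _ kw)// /z mulr2n; lra.
have ijmk : (i * k + j < m * k)%N.
  by rewrite (@leq_trans (i.+1 * k))// ?leq_mul2r ?im ?orbT// mulSn addnC ltn_add2r.
exists (Ordinal ijmk) => //=.
have k0 : (0 < k)%N by rewrite (leq_ltn_trans _ jk).
rewrite /eball/= divnMDl// divn_small// addn0 modnMDl modn_small//.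
have e0 : 0 < e by rewrite (lt_le_trans _ we)// mulrn_wgt0.
rewrite -[ltRHS](gtr0_norm e0) -sqrtr_sqr ltr_sqrt ?exprn_gt0//.
have -> : y - (f (i%:R * w) - A + j%:R * w) = z - j%:R * w by rewrite /z; ring.
have s1 : (x - i%:R * w) ^+ 2 < w ^+ 2.
  by rewrite ltrXn2r// ?nnegrE ?subr_ge0// ?(ltW w0)// ltrBlDl.
have s2 : (z - j%:R * w) ^+ 2 < w ^+ 2.
  by rewrite ltrXn2r// ?nnegrE ?subr_ge0// ?(ltW w0)// ltrBlDl.
have : (w *+ 2) ^+ 2 <= e ^+ 2 by rewrite lerXn2r// ?nnegrE ?mulrn_wge0// ltW.
rewrite mulr2n sqrrD mulr2n -expr2; have := sqr_ge0 w; lra.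
Qed.

Lemma dyadic_scale e : 0 < e <= 1 ->
  exists J : nat, (2 ^+ J.+1)^-1 < e <= (2 ^+ J)^-1.
Proof.
move=> /andP[e0 e1].
have ex : exists J : nat, (2 ^+ J)^-1 < e.
  exists (Num.bound e^-1); rewrite invf_plt ?posrE ?exprn_gt0//.
  rewrite (lt_le_trans (archi_boundP _))// ?invr_ge0 ?(ltW e0)//.
  by rewrite -natrX ler_nat ltnW// ltn_expl.
case: (ex_minnP ex) => -[|J] HJ Jmin.
  by move: HJ; rewrite expr0 invr1 ltNge e1.
exists J; rewrite HJ/= leNgt; apply/negP => /Jmin; by rewrite ltnn.
Qed.

Lemma covering_number_graph_le (f : R -> R) (E rho e : R) (J : nat) :
  0 <= E -> 1 < rho < 2 ->
  (forall J x h, `|h| <= (2 ^+ J)^-1 -> `|f (x + h) - f x| <= E * (rho / 2) ^+ J) ->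
  (2 ^+ J.+1)^-1 < e <= (2 ^+ J)^-1 ->
  (covering_number (graph_torus f) e)%:R <= 32 * (8 * E + 1) * (2 * rho) ^+ J.
Proof.
move=> E0 /andP[rho1 rho2] fE /andP[eJ Je].
have p2 (n : nat) : 0 < 2 ^+ n :> R by rewrite exprn_gt0.
(* Then 2w = 2^-(J+1) < e, as the covering by squares requires. *)
pose w : R := (2 ^+ J.+2)^-1.
have w0 : 0 < w by rewrite invr_gt0.
have w2 : w *+ 2 = (2 ^+ J.+1)^-1.
  by rewrite /w exprS -mulr_natr; field; rewrite gt_eqF.
pose A := E * (rho / 2) ^+ J.
have q0 : 0 < rho / 2 by rewrite divr_gt0// (lt_trans _ rho1).
have A0 : 0 <= A by rewrite mulr_ge0// exprn_ge0// ltW.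
have Aw0 : 0 <= A *+ 2 / w by rewrite divr_ge0 ?mulrn_wge0// ltW.
(* Since 2 pi < 8, these columns cover a period. *)
pose m : nat := (8 * 2 ^ J.+2)%N.
pose k : nat := (Num.truncn (A *+ 2 / w)).+1.
have := truncn_itv Aw0; rewrite -/k => /andP[k1 k2].
have mw : m%:R * w = 8 by rewrite /m natrM natrX /w -mulrA divff ?mulr1// gt_eqF.
have : coverable (graph_torus f) e (m * k).
  apply: (@graph_coverable f w A) => //.
  - by rewrite w2 ltW.
  - by rewrite mw -mulr_natr; have := @pihalf_lt2 R; lra.
  - by rewrite -ltr_pdivrMr.
  - move=> x h /andP[h0 hw]; apply: fE; rewrite ger0_norm// (le_trans hw)//.
    by rewrite /w lef_pV2 ?posrE// ler_eXn2l ?ltr1n// (leq_trans (leqnSn _) (leqnSn _)).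
move=> /covering_numberP[_ le].
apply: (@le_trans _ _ (m * k)%N%:R); first by rewrite ler_nat.
have mE : m%:R = 32 * 2 ^+ J :> R by rewrite /m natrM natrX !exprS; ring.
have kE : k%:R <= 8 * E * rho ^+ J + 1.
  rewrite /k -natr1 lerD2r (le_trans k1)// /A /w invrK expr_div_n mulr2n !exprS.
  rewrite le_eqVlt; apply/orP; left; apply/eqP; field.
  by rewrite gt_eqF.
have r1 : 1 <= rho ^+ J by rewrite exprn_ege1// ltW.
rewrite natrM mE exprMn.
have -> : 32 * (8 * E + 1) * (2 ^+ J * rho ^+ J) =
  32 * 2 ^+ J * (8 * E * rho ^+ J + rho ^+ J) by ring.
rewrite ler_wpM2l// ?mulr_ge0 ?(ltW (p2 J))// (le_trans kE)// lerD2l//.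
Qed.

(** At scale 2^-J the graph needs O((2 rho)^J) balls, and ln((2 rho)^J) / ln(2^J) = 1 + ln rho / ln
    2. *)
Lemma fractal_dim_graph_le (f : R -> R) (E rho : R) : 0 <= E -> 1 < rho < 2 ->
  (forall J x h, `|h| <= (2 ^+ J)^-1 -> `|f (x + h) - f x| <= E * (rho / 2) ^+ J) ->
  (fractal_dim (graph_torus f) <= (1 + ln rho / ln 2)%:E)%E.
Proof.
move=> E0 rho12 fE; have /andP[rho1 rho2] := rho12.
have rho0 : 0 < rho by rewrite (lt_trans _ rho1).
have ln2 : 0 < ln 2 :> R by rewrite ln_gt0// ltr1n.
have lnr : 0 < ln rho by rewrite ln_gt0.
apply: limf_esup_right_le => eta eta0.
pose C := 32 * (8 * E + 1).
have C1 : 1 <= C by rewrite /C; lra.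
have C0 : 0 < C by rewrite (lt_le_trans _ C1).
have lnC : 0 <= ln C by rewrite ln_ge0.
(* Below this threshold the constant [C] costs at most eta ln(1/e). *)
exists (Num.min 2^-1 (expR (- (ln C / eta)))).
  by rewrite lt_min invr_gt0 ltr0n expR_gt0.
move=> e /andP[e0]; rewrite lt_min => /andP[e2 eC].
have e01 : 0 < e <= 1 by rewrite e0/=; lra.
have [J eJ] := dyadic_scale e01; have /andP[eJ1 eJ2] := eJ.
have NJ := covering_number_graph_le E0 rho12 fE eJ.
rewrite div1r lnV ?posrE//.
have lne : ln C / eta < - ln e.
  by rewrite ltrNr -[ltRHS]expRK ltr_ln ?posrE ?expR_gt0.
have lne2 : J%:R * ln 2 <= - ln e.
  rewrite lerNr.
  have : ln e <= ln (2 ^+ J)^-1 by rewrite ler_ln ?posrE ?invr_gt0 ?exprn_gt0.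
  by rewrite lnV ?posrE ?exprn_gt0// lnXn// -[ln 2 *+ _]mulr_natl.
have lnep : 0 < - ln e by rewrite (le_lt_trans _ lne)// divr_ge0// ltW.
rewrite ler_pdivrMr//.
have J0 : 0 <= J%:R :> R by [].
have key : ln (covering_number (graph_torus f) e)%:R <= ln C + J%:R * (ln 2 + ln rho).
  have [->|N0] := eqVneq (covering_number (graph_torus f) e) 0%N.
    by rewrite ln0// addr_ge0// mulr_ge0// addr_ge0 ?ltW.
  have -> : ln C + J%:R * (ln 2 + ln rho) = ln (C * (2 * rho) ^+ J).
    have r2 : 0 < 2 * rho by rewrite mulr_gt0.
    have L1 : ln (C * (2 * rho) ^+ J) = ln C + ln ((2 * rho) ^+ J).
      by rewrite lnM ?posrE// exprn_gt0.
    have L2 : ln (2 * rho) = ln 2 + ln rho by rewrite lnM ?posrE.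
    by rewrite L1 lnXn// L2 -[X in _ = _ + X]mulr_natl.
  have Np : 0 < (covering_number (graph_torus f) e)%:R :> R by rewrite ltr0n lt0n.
  have Xp : 0 < C * (2 * rho) ^+ J := lt_le_trans Np NJ.
  by rewrite ler_ln.
rewrite (le_trans key)//.
have h1 : ln C <= eta * - ln e by rewrite mulrC -ler_pdivrMr// ltW.
have h2 : J%:R * (ln 2 + ln rho) <= (1 + ln rho / ln 2) * - ln e.
  have -> : J%:R * (ln 2 + ln rho) = (1 + ln rho / ln 2) * (J%:R * ln 2).
    by field; rewrite gt_eqF.
  by rewrite ler_wpM2l// addr_ge0// divr_ge0// ltW.
rewrite mulrDl addrC lerD//.
Qed.

End UpperDimension.

(** * Lower bound for the dimension *)

Section ColumnOscillation.
Variable R : realType.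
Implicit Types (e w : R) (f : R -> R).

Lemma eball_fst (c p : R * R) e : eball c e p -> `|p.1 - c.1| < e.
Proof.
rewrite /eball/=; apply: le_lt_trans.
by rewrite -sqrtr_sqr ler_wsqrtr// lerDl sqr_ge0.
Qed.

Lemma eball_snd (c p : R * R) e : eball c e p -> `|p.2 - c.2| < e.
Proof.
rewrite /eball/=; apply: le_lt_trans.
by rewrite -sqrtr_sqr ler_wsqrtr// lerDr sqr_ge0.
Qed.

(* A column of the graph is a connected curve, so the balls meeting it project
   onto a cover of its vertical extent. *)
Lemma oscillation_le_balls f e n (c : 'I_n -> R * R) (A : {set 'I_n}) a b : 0 < e ->
  continuous f -> a <= b ->
  (forall x, a <= x <= b -> exists2 k, k \in A & eball (c k) e (x, f x)) ->
  forall x y, a <= x <= b -> a <= y <= b -> f y - f x <= 2 * e * #|A|%:R.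
Proof.
move=> e0 cf ab cov x y xab yab; rewrite leNgt; apply/negP => lt.
have e20 : 0 < 2 * e by rewrite mulr_gt0.
(* Take one level more than there are balls, the levels being 2e apart. An open ball of radius [e]
   meets at most one level, so the levels would inject into [A]. *)
have pts (l : 'I_#|A|.+1) : exists k, k \in A /\ exists z,
    eball (c k) e (z, f x + 2 * e * l%:R).
  have l0 : 0 <= 2 * e * l%:R by rewrite mulr_ge0// ltW.
  have l1 : 2 * e * l%:R <= 2 * e * #|A|%:R.
    by rewrite ler_pM2l// ler_nat -ltnS.
  have xy : f x <= f y by lra.
  have [z zI fz] : exists2 z, a <= z <= b & f z = f x + 2 * e * l%:R.
    have [xley|/ltW ylex] := leP x y.
      have [||z + fz] := @IVT R f x y (f x + 2 * e * l%:R) xley.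
      - exact: continuous_subspaceT.
      - by rewrite ge_min le_max; apply/andP; split; apply/orP; [left|right]; lra.
      rewrite in_itv/= => /andP[xz zy]; exists z => //.
      by move: xab yab => /andP[? ?] /andP[? ?]; apply/andP; split; lra.
    have [||z + fz] := @IVT R f y x (f x + 2 * e * l%:R) ylex.
    - exact: continuous_subspaceT.
    - by rewrite ge_min le_max; apply/andP; split; apply/orP; [right|left]; lra.
    rewrite in_itv/= => /andP[yz zx]; exists z => //.
    by move: xab yab => /andP[? ?] /andP[? ?]; apply/andP; split; lra.
  have [k kA ek] := cov z zI.
  by exists k; split => //; exists z; rewrite -fz.
have [k Hk] := choice pts.
have kinj : injective k.
  move=> l l' kk; apply/val_inj/eqP; rewrite -(eqr_nat R).
  have [_ [z /eball_snd/= H]] := Hk l; have [_ [z' /eball_snd/= H']] := Hk l'.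
  move: H H'; rewrite kk !ltr_norml => /andP[H1 H2] /andP[H3 H4].
  have d1 : (l%:R - l'%:R : R) < 1 by rewrite -(ltr_pM2l e20); lra.
  have d2 : (l'%:R - l%:R : R) < 1 by rewrite -(ltr_pM2l e20); lra.
  rewrite eqr_nat eqn_leq.
  by apply/andP; split; rewrite -ltnS -(ltr_nat R) -natr1; lra.
have : (#|codom k| <= #|A|)%N.
  by apply: subset_leq_card; apply/fintype.subsetP => _ /codomP[l ->]; exact: (Hk l).1.
by rewrite card_codom// card_ord ltnn.
Qed.

(** The oscillation over a column is at most 2e times the number of balls whose centre projects
    within [e] of it; as 2e <= w, a ball is counted for at most two columns. *)
Lemma column_oscillation f (m n : nat) w e : continuous f -> (0 < m)%N ->
  w = pi *+ 2 / m%:R -> 0 < e -> 2 * e <= w ->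
  coverable (graph_torus f) e n ->
  exists O : nat -> R, [/\ forall i, 0 <= O i,
    (forall i x y, (i < m)%N -> i%:R * w <= x <= i.+1%:R * w ->
       i%:R * w <= y <= i.+1%:R * w -> `|f x - f y| <= O i) &
    \sum_(i < m) O i <= 4 * e * n%:R].
Proof.
move=> cf m0 wE e0 ew [c cov].
have mR : 0 < m%:R :> R by rewrite ltr0n.
have w0 : 0 < w by rewrite wE divr_gt0// mulrn_wgt0// pi_gt0.
have mw : m%:R * w = pi *+ 2 by rewrite wE mulrC divfK// gt_eqF.
pose A (i : nat) : {set 'I_n} :=
  [set k | (i%:R * w - e < (c k).1) && ((c k).1 < i.+1%:R * w + e)]%SET.
exists (fun i => 2 * e * #|A i|%:R); split.
- by move=> i; rewrite !mulr_ge0// ltW.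
- move=> i x y im xI yI.
  have colcov z : i%:R * w <= z <= i.+1%:R * w ->
      exists2 k, k \in A i & eball (c k) e (z, f z).
    move=> /andP[z1 z2].
    have [|k _ ek] := cov (z, f z).
      split => //=; rewrite in_itv/= -mw; apply/andP; split.
        by rewrite (le_trans _ z1)// mulr_ge0// ltW.
      by rewrite (le_trans z2)// ler_pM2r// ler_nat.
    exists k => //; have := eball_fst ek; rewrite inE/= ltr_norml => /andP[k1 k2].
    by apply/andP; split; lra.
  have ii : i%:R * w <= i.+1%:R * w by rewrite ler_pM2r// ler_nat.
  have H := oscillation_le_balls e0 cf ii colcov.
  by rewrite ler_norml; apply/andP; split; [rewrite lerNl opprB|]; apply: H.
(* Columns sharing a ball have indices differing by at most 1, and no three distinct integers are
   pairwise that close. *)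
- have two (k : 'I_n) : (#|[set i : 'I_m | k \in A i]%SET| <= 2)%N.
    rewrite leqNgt; apply/negP => /card_gt2P[i1 [i2 [i3 [[]]]]].
    have near (i i' : 'I_m) : i \in [set i : 'I_m | k \in A i]%SET ->
        i' \in [set i : 'I_m | k \in A i]%SET -> (i' <= i.+1)%N.
      rewrite !inE => /andP[_ h1] /andP[h2 _]; rewrite -ltnS -(ltr_nat R).
      by rewrite -(ltr_pM2r w0) -natr1 mulrDl mul1r; lra.
    move=> a1 a2 a3 [n12 n23 n31].
    have := near _ _ a1 a2; have := near _ _ a2 a1; have := near _ _ a1 a3.
    have := near _ _ a3 a1; have := near _ _ a2 a3; have := near _ _ a3 a2.
    by move: n12 n23 n31; rewrite -!val_eqE/=; lia.
  have : (\sum_(i < m) #|A i| <= 2 * n)%N.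
    rewrite (eq_bigr (fun i : 'I_m => \sum_(k < n | k \in A i) 1)%N); last first.
      by move=> i _; rewrite sum1_card.
    under eq_bigr do rewrite big_mkcond.
    rewrite exchange_big/=.
    apply: (@leq_trans (\sum_(k < n) 2)%N); last by rewrite sum_nat_const card_ord mulnC.
    apply: leq_sum => k _; rewrite -big_mkcond/= sum1_card.
    by apply: leq_trans (two k); rewrite cardsE.
  rewrite -mulr_sumr -natr_sum -(ler_nat R) natrM => le.
  have -> : 4 * e * n%:R = 2 * e * (2 * n%:R) by ring.
  by rewrite ler_pM2l// mulr_gt0.
Qed.

End ColumnOscillation.

(** * Parseval's identity on equispaced grids *)

Section DiscreteParseval.
Variable R : realType.
Implicit Types (x y theta w e : R).

Lemma cexp_neq1 x : 0 < `|x| < pi *+ 2 -> cexp x != 1.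
Proof.
move=> /andP[x0 xpi]; apply/negP => /eqP cx.
have s0 : `|sin (x / 2)| = 0.
  have := normc_cexpB1 (x / 2).
  have -> : x / 2 *+ 2 = x by rewrite -mulr_natr divfK.
  rewrite cx subrr normc0.
  lra.
have : 0 < sin (`|x| / 2).
  by rewrite sin_gt0_pi// divr_gt0//= ltr_pdivrMr// mulr_natr.
have -> : sin (`|x| / 2) = Num.sg x * sin (x / 2).
  by rewrite -sin_sg [Num.sg x * _]mulrA -normrEsg.
by move/normr0_eq0: s0 => ->; rewrite mulr0 ltxx.
Qed.

Lemma discrete_orthogonality (K : nat) (l l' : nat) : (l < K)%N -> (l' < K)%N ->
  \sum_(k < K) cexp ((l%:R - l'%:R) * (pi *+ 2 / K%:R) * k%:R : R) =
  ((l == l')%:R * K%:R)%:C.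
Proof.
move=> lK lK'; have [->|ll] := eqVneq l l'.
  under eq_bigr do rewrite subrr !mul0r cexp0.
  by rewrite sumr_const card_ord mul1r rmorph_nat.
rewrite mul0r; set d : R := l%:R - l'%:R.
have KR : 0 < K%:R :> R by rewrite ltr0n (leq_ltn_trans _ lK).
have P0 : 0 < pi *+ 2 :> R by rewrite mulrn_wgt0// pi_gt0.
pose z := cexp (d * (pi *+ 2 / K%:R)).
under eq_bigr do rewrite mulr_natr cexpMn -/z.
have zK : z ^+ K = 1.
  rewrite /z -cexpMn -[_ *+ K]mulr_natr -mulrA divfK ?gt_eqF//.
  have -> : d = (l%:Z - l'%:Z)%:~R by rewrite rmorphB/= -!pmulrn.
  exact: cexp2piz.
have z1 : z != 1.
  apply: cexp_neq1; rewrite normrM (gtr0_norm (divr_gt0 P0 KR)).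
  have dK : `|d| < K%:R.
    rewrite ltr_norml /d; have := lK; have := lK'.
    rewrite -!(ltr_nat R); have := ler0n R l; have := ler0n R l'; lra.
  apply/andP; split; last by rewrite mulrCA gtr_pMr// ltr_pdivrMr// mul1r.
  by rewrite mulr_gt0 ?divr_gt0// normr_gt0 subr_eq0 eqr_nat.
apply/eqP; have := subrX1 z K; rewrite zK subrr => /esym/eqP.
by rewrite mulf_eq0 subr_eq0 (negbTE z1).
Qed.

Lemma sqnorm_mul_conj (z : R[i]) : (sqnorm z)%:C = z * conjc z.
Proof. by case: z => a b; rewrite /sqnorm /=; simpc; congr (_ +i* _); ring. Qed.

Lemma sqnormM (z z' : R[i]) : sqnorm (z * z') = sqnorm z * sqnorm z'.
Proof. by rewrite !sqnormE normcM exprMn. Qed.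

Lemma sqnorm_cexp x : sqnorm (cexp x) = 1.
Proof. by rewrite sqnormE normc_cexp expr1n. Qed.

(** The condition L <= K excludes aliasing: the frequencies are distinct modulo [K], so the
    exponentials are orthogonal on the grid. *)
Lemma discrete_Parseval (c : nat -> R[i]) (K L : nat) : (L <= K)%N ->
  \sum_(k < K) sqnorm (\sum_(l < L) c l * cexp (l%:R * (pi *+ 2 / K%:R) * k%:R)) =
  K%:R * \sum_(l < L) sqnorm (c l).
Proof.
move=> LK; apply: (@complexI R); rewrite rmorph_sum/=.
set th := pi *+ 2 / K%:R.
have E (k : nat) : (sqnorm (\sum_(l < L) c l * cexp (l%:R * th * k%:R)))%:C =
    \sum_(l < L) \sum_(l' < L) c l * conjc (c l') *
      cexp ((l%:R - l'%:R) * th * k%:R).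
  have conjM (z z' : R[i]) : conjc (z * z') = conjc z * conjc z'.
    by case: z z' => u v [u' v']; simpc; congr (_ +i* _); ring.
  have conjD (z z' : R[i]) : conjc (z + z') = conjc z + conjc z'.
    by case: z z' => u v [u' v']; simpc; congr (_ +i* _); ring.
  have conj0 : conjc (0 : R[i]) = 0 by exact: conjc0.
  rewrite sqnorm_mul_conj (big_morph _ conjD conj0) mulr_suml.
  apply: eq_bigr => l _; rewrite mulr_sumr; apply: eq_bigr => l' _.
  by rewrite conjM conjc_cexp !mulrBl cexpD; ring.
rewrite (eq_bigr _ (fun (k : 'I_K) _ => E k)).
rewrite exchange_big/= rmorphM/= rmorph_sum/= mulr_sumr.
apply: eq_bigr => l _; rewrite exchange_big/=.
have F (l' : 'I_L) : \sum_(k < K) c l * conjc (c l') *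
    cexp ((l%:R - l'%:R) * th * k%:R) =
    c l * conjc (c l') * ((l == l' :> nat)%:R * K%:R)%:C.
  by rewrite -mulr_sumr discrete_orthogonality// (leq_trans (ltn_ord _) LK).
rewrite (eq_bigr _ (fun l' _ => F l')) (bigD1 l)//= [X in _ + X]big1 ?addr0.
  by rewrite eqxx mul1r -sqnorm_mul_conj mulrC.
move=> l' ll'.
by rewrite eq_sym (negbTE ll' : (val l' == val l) = false) mul0r mulr0.
Qed.

End DiscreteParseval.

Section ShiftVariation.
Variable R : realType.
Implicit Types (h : R -> R) (e w : R).

(** Each of the [r] grid points of a column is carried into the next one, and passing through the
    common endpoint costs the two oscillations. Periodicity brings the last column back to the
    first, so every oscillation is counted twice, whence 8 from 4. *)
Lemma shift_variation h (m r n : nat) w e : continuous h ->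
  periodic h (pi *+ 2) -> (0 < m)%N -> (0 < r)%N -> w = pi *+ 2 / m%:R ->
  0 < e -> 2 * e <= w -> coverable (graph_torus h) e n ->
  \sum_(p < m * r) `|h (p%:R * (w / r%:R) + w) - h (p%:R * (w / r%:R))| <=
  8 * r%:R * e * n%:R.
Proof.
move=> ch hper m0 r0 wE e0 ew cov.
have [Q [Q0 HO sO]] := column_oscillation ch m0 wE e0 ew cov.
have mR : 0 < m%:R :> R by rewrite ltr0n.
have rR : 0 < r%:R :> R by rewrite ltr0n.
have w0 : 0 < w by rewrite wE divr_gt0// mulrn_wgt0// pi_gt0.
have mw : m%:R * w = pi *+ 2 by rewrite wE mulrC divfK// gt_eqF.
have cell i (p : nat) : (i * r <= p < i.+1 * r)%N ->
    i%:R * w <= p%:R * (w / r%:R) <= i.+1%:R * w.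
  move=> /andP[ip pi1]; rewrite mulrA ler_pdivlMr// ler_pdivrMr//.
  by rewrite ![_ * w * _]mulrAC !ler_pM2r// -!natrM !ler_nat ip ltnW.
have bnd i p : (i < m)%N -> (i * r <= p < i.+1 * r)%N ->
    `|h (p%:R * (w / r%:R) + w) - h (p%:R * (w / r%:R))| <= Q (i.+1 %% m)%N + Q i.
  move=> im /cell; set x := p%:R * _ => /andP[x1 x2].
  have ii : i%:R * w <= i.+1%:R * w by rewrite ler_pM2r// ler_nat.
  rewrite -(subrKA (h (i.+1%:R * w))) (le_trans (ler_normD _ _))// lerD//; last first.
    by apply: HO => //; rewrite ?x1 ?x2 ?ii ?lexx.
  have S1 (k : nat) : k.+1%:R * w = k%:R * w + w by rewrite -natr1 mulrDl mul1r.
  have [im1|mi] := ltnP i.+1 m.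
    rewrite modn_small//; apply: HO => //; rewrite ?S1 ?lexx ?lerD2r//=.
      by rewrite -S1 x1 x2.
    by rewrite lerDl ltW.
  have im2 : i.+1 = m by apply/eqP; rewrite eqn_leq im mi.
  rewrite im2 modnn mw -[h (pi *+ 2)]/(h (pi *+ 2)).
  have -> : h (pi *+ 2) = h 0 by rewrite -[pi *+ 2]add0r hper.
  have -> : h (x + w) = h (x + w - pi *+ 2) by rewrite -[in LHS](subrK (pi *+ 2) (x + w)) hper.
  have := S1 i; rewrite im2 mw => E2.
  have : i.+1%:R * w = pi *+ 2 by rewrite im2 mw.
  move: x2 => /[swap] -> x2.
  by apply: HO => //; rewrite mul0r mul1r; apply/andP; split; lra.
have Etot : \sum_(p < m * r) `|h (p%:R * (w / r%:R) + w) - h (p%:R * (w / r%:R))| <=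
    \sum_(i < m) r%:R * (Q (i.+1 %% m)%N + Q i).
  rewrite -(big_mkord xpredT (fun p : nat =>
    `|h (p%:R * (w / r%:R) + w) - h (p%:R * (w / r%:R))|)).
  rewrite big_nat_mul big_mkord ler_sum// => i _.
  apply: (@le_trans _ _ (\sum_(i * r <= p < i.+1 * r) (Q (i.+1 %% m)%N + Q i))).
    rewrite !big_nat ler_sum// => p pI; exact: bnd.
  by rewrite sumr_const_nat mulSn addnK -[leLHS]mulr_natl.
rewrite (le_trans Etot)// -mulr_sumr big_split/=.
have shift : \sum_(i < m) Q (i.+1 %% m)%N = \sum_(i < m) Q i.
  case: m m0 {wE mR mw sO HO bnd Etot cov cell} => // m _.
  rewrite big_ord_recr [RHS]big_ord_recl/= modnn addrC; congr (_ + _).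
  by apply: eq_bigr => i _; rewrite modn_small ?ltnS.
rewrite shift.
have -> : 8 * r%:R * e * n%:R = r%:R * (4 * e * n%:R + 4 * e * n%:R) by ring.
by rewrite ler_pM2l// lerD.
Qed.

End ShiftVariation.

Section BlockEnergy.
Variable R : realType.
Variable g : R -> R[i].
Variable t : R.
Implicit Types (x w e : R) (u : R -> R[i]).

Notation S := (evolution_partial (@boussinesq R) g t).

Definition block_energy (j : nat) : R := \sum_(2 ^ j <= k < 2 ^ j.+1)
  (sqnorm (fourier g k%:Z) + sqnorm (fourier g (- k%:Z))).

Lemma sqnorm_ge0 (z : R[i]) : 0 <= sqnorm z.
Proof. by rewrite sqnormE sqr_ge0. Qed.

(** This [w] puts kw between pi/2 and pi for every [k] of the block. The cosine is at most 0 there,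
    so differencing with step [w] does not attenuate the block. *)
Lemma sqnorm_shift_ge2 (j k : nat) w : (2 ^ j <= k < 2 ^ j.+1)%N ->
  w = pi *+ 2 / (2 ^ j.+2)%:R ->
  2 <= sqnorm (cexp (k%:R * w) - 1) /\ 2 <= sqnorm (cexp (- (k%:R * w)) - 1).
Proof.
move=> /andP[k1 k2] wE; rewrite !sqnorm_cexpB1 cosN.
have p0 : 0 < 2 ^+ j :> R by rewrite exprn_gt0.
have pi0 := @pi_gt0 R.
have kR1 : 2 ^+ j <= k%:R :> R by rewrite -natrX ler_nat.
have kR2 : k%:R <= 2 * 2 ^+ j :> R by rewrite -exprS -natrX ler_nat ltnW.
have kw : k%:R * w = k%:R / 2 ^+ j * (pi / 2).
  by rewrite wE natrX !exprS mulr2n; field; rewrite gt_eqF.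
have q1 : 1 <= k%:R / 2 ^+ j :> R by rewrite ler_pdivlMr// mul1r.
have q2 : k%:R / 2 ^+ j <= 2 :> R by rewrite ler_pdivrMr.
suff : cos (k%:R * w) <= 0 by move=> ?; split; lra.
rewrite kw -[_ * (pi / 2)](subrK (pi / 2)) cosDpihalf oppr_le0 sin_ge0_pi//.
by move: (k%:R / _) q1 q2 => q q1 q2; apply/andP; split; nra.
Qed.

(** Multiplication by exp(iMx) moves the frequencies from [-M, M] to [0, 2M], where the discrete
    identity applies. The dispersive factors have modulus 1, so [t] disappears from the energy. *)
Lemma evolution_shift_Parseval (M K : nat) w : (M.*2.+1 <= K)%N ->
  \sum_(p < K) sqnorm (S M (p%:R * (pi *+ 2 / K%:R) + w) - S M (p%:R * (pi *+ 2 / K%:R))) =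
  K%:R * \sum_(k < M.*2.+1) (let n : int := k%:Z - M%:Z in
    sqnorm (fourier g n) * sqnorm (cexp (n%:~R * w) - 1)).
Proof.
move=> MK; set th := pi *+ 2 / K%:R.
pose c (k : nat) : R[i] := let n : int := k%:Z - M%:Z in
  fourier g n * cexp (t * boussinesq R n) * (cexp (n%:~R * w) - 1).
have cE k : sqnorm (c k) = let n : int := k%:Z - M%:Z in
    sqnorm (fourier g n) * sqnorm (cexp (n%:~R * w) - 1).
  by rewrite /c /= !sqnormM sqnorm_cexp mulr1.
under [in RHS]eq_bigr do rewrite -cE.
rewrite -discrete_Parseval// -/th; apply: eq_bigr => p _.
set x := p%:R * th.
have -> : S M (x + w) - S M x = cexp (- (M%:R * x)) *
    \sum_(l < M.*2.+1) c l * cexp (l%:R * th * p%:R).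
  rewrite /evolution_partial -sumrB mulr_sumr; apply: eq_bigr => l _ /=.
  rewrite /c; set n : int := l%:Z - M%:Z.
  have -> : l%:R * th * p%:R = n%:~R * x + M%:R * x.
    rewrite /n rmorphB/= -!pmulrn /x; ring.
  rewrite [cexp (n%:~R * x + _)]cexpD.
  have swap (a b b' d : R[i]) : b * (a * (d * b')) = b * b' * (a * d) by ring.
  by rewrite swap cexpNM mul1r mulrDr addrA !cexpD; ring.
by rewrite sqnormM sqnorm_cexp mul1r.
Qed.

Lemma block_energy_shift (j M : nat) w : (2 ^ j.+1 <= M.+1)%N ->
  w = pi *+ 2 / (2 ^ j.+2)%:R ->
  2 * block_energy j <= \sum_(k < M.*2.+1) (let n : int := k%:Z - M%:Z in
    sqnorm (fourier g n) * sqnorm (cexp (n%:~R * w) - 1)).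
Proof.
move=> jM wE.
pose F (n : int) : R := sqnorm (fourier g n) * sqnorm (cexp (n%:~R * w) - 1).
have F0 n : 0 <= F n by rewrite mulr_ge0 ?sqnorm_ge0.
rewrite (sum_symmetric F M) (@le_trans _ _ (\sum_(1 <= m < M.+1) (F m%:Z + F (- m%:Z))))//.
  2: by rewrite lerDr.
rewrite (@big_cat_nat _ _ _ (2 ^ j.+1))//= ?expn_gt0//.
rewrite (@big_cat_nat _ _ _ (2 ^ j))//= ?expn_gt0//; last by rewrite leq_exp2l.
rewrite -[leLHS]addr0 lerD//; last by rewrite sumr_ge0// => k _; rewrite addr_ge0.
rewrite -[leLHS]add0r lerD//; first by rewrite sumr_ge0// => k _; rewrite addr_ge0.
rewrite /block_energy mulr_sumr !big_nat ler_sum// => k kj.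
have [h1 h2] := sqnorm_shift_ge2 kj wE.
rewrite mulrDr lerD// /F mulrC ler_wpM2l ?sqnorm_ge0//.
by rewrite mulrNz mulNr -pmulrn.
Qed.

(** For the modulus v of an increment of [u], v^2 <= A v turns the quadratic sum of Parseval into
    the linear one that the coverings control. A partial sum [S M] stands for [u] up to a uniform
    error [d]. *)
Lemma block_energy_bound u (j nR nI : nat) w e A :
  uniform_evolution g t u -> uniform_modulus u ->
  w = pi *+ 2 / (2 ^ j.+2)%:R -> 0 < e -> 2 * e <= w ->
  (forall x, normc (u (x + w) - u x) <= A) ->
  coverable (graph_torus (fun x => complex.Re (u x))) e nR ->
  coverable (graph_torus (fun x => complex.Im (u x))) e nI ->
  block_energy j <= 8 * A * e * (nR + nI)%:R / (2 ^ j.+2)%:R.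
Proof.
move=> ue um wE e0 ew uA covR covI.
have per := uniform_evolution_periodic ue.
have A0 : 0 <= A by rewrite (le_trans (normc_ge0 _) (uA 0)).
set m := (2 ^ j.+2)%N in wE *.
have m0 : (0 < m)%N by rewrite expn_gt0.
have mR : 0 < m%:R :> R by rewrite ltr0n.
apply/ler_addgt0Pr => eps eps0.
(* The approximation adds 8 d^2 to twice the energy, that is [eps] to the energy. *)
pose d := Num.sqrt (eps / 4).
have d0 : 0 < d by rewrite sqrtr_gt0 divr_gt0.
have d2 : d ^+ 2 = eps / 4 by rewrite sqr_sqrtr// divr_ge0// ltW.
have [N0 HN] := ue d d0.
(* [M] reaches past the block, and r = 2M + 1 makes the grid of m r points fine enough for
   Parseval. *)
pose M := maxn N0 (2 ^ j.+1).
pose r := M.*2.+1.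
have rR : 0 < r%:R :> R by rewrite ltr0n.
have MK : (M.*2.+1 <= m * r)%N by rewrite leq_pmull.
have jM : (2 ^ j.+1 <= M.+1)%N by rewrite (leq_trans (leq_maxr N0 _)).
have KE : pi *+ 2 / (m * r)%N%:R = w / r%:R by rewrite natrM wE invfM mulrA.
have P := evolution_shift_Parseval w MK; rewrite KE in P.
have low := block_energy_shift jM wE.
have vR := shift_variation (uniform_modulus_Re um) _ m0 (isT : (0 < r)%N) wE e0 ew covR.
have vI := shift_variation (uniform_modulus_Im um) _ m0 (isT : (0 < r)%N) wE e0 ew covI.
have {}vR := vR (fun x => congr1 (@complex.Re R) (per x)).
have {}vI := vI (fun x => congr1 (@complex.Im R) (per x)).
have pt x : sqnorm (S M (x + w) - S M x) <=
   2 * A * (`|complex.Re (u (x + w)) - complex.Re (u x)| +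
     `|complex.Im (u (x + w)) - complex.Im (u x)|) + 8 * d ^+ 2.
  have a1 := HN M (x + w) (leq_maxl _ _); have a2 := HN M x (leq_maxl _ _).
  have a3 := normc_le_ReIm (u (x + w) - u x); rewrite ReB ImB in a3.
  have a4 := uA x.
  set v := normc (u (x + w) - u x) in a3 a4.
  have a5 : normc (S M (x + w) - S M x) <= v + 2 * d.
    have -> : S M (x + w) - S M x = (u (x + w) - u x) +
      ((S M (x + w) - u (x + w)) - (S M x - u x)) by ring.
    rewrite (le_trans (normcD _ _))// lerD// (le_trans (normcB _ _))//.
    by rewrite mulr_natl mulr2n lerD.
  have v0 : 0 <= v := normc_ge0 _.
  rewrite sqnormE (@le_trans _ _ ((v + 2 * d) ^+ 2))//.
    by rewrite ler_pXn2r ?nnegrE ?normc_ge0//; lra.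
  have : v ^+ 2 <= A * (`|complex.Re (u (x + w)) - complex.Re (u x)| +
     `|complex.Im (u (x + w)) - complex.Im (u x)|) by rewrite expr2 ler_pM.
  (* This is (v + 2d)^2 <= 2 v^2 + 8 d^2. *)
  have := sqr_ge0 (v - 2 * d); rewrite sqrrB sqrrD !exprMn !mulr2n; lra.
have K0 : 0 < (m * r)%N%:R :> R by rewrite natrM mulr_gt0.
have H : (m * r)%N%:R * (2 * block_energy j) <=
    2 * A * (8 * r%:R * e * nR%:R + 8 * r%:R * e * nI%:R) +
    (m * r)%N%:R * (8 * d ^+ 2).
  rewrite (le_trans (ler_wpM2l (ltW K0) low))// -P.
  rewrite (le_trans (ler_sum _ (fun (p : 'I_(m * r)) _ => pt (p%:R * (w / r%:R)))))//.
  rewrite big_split/= sumr_const card_ord -[X in _ + X <= _]mulr_natl lerD2r.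
  by rewrite -mulr_sumr big_split/= ler_wpM2l ?mulr_ge0// lerD.
rewrite -(ler_pM2l K0) -(ler_pM2l (_ : 0 < 2 :> R))//.
have e1 : 2 * ((m * r)%:R * block_energy j) = (m * r)%:R * (2 * block_energy j) by ring.
rewrite e1 (le_trans H)// d2 natrD natrM le_eqVlt; apply/orP; left; apply/eqP.
by field; rewrite gt_eqF.
Qed.

End BlockEnergy.

(** * Sobolev regularity from dyadic energies *)

Section SobolevFromBlocks.
Variable R : realType.
Implicit Types (a : int -> R) (g : R -> R[i]).

(** Any finite set of integers lies in some [-M, M] with M + 1 = 2^J, and the terms are
    nonnegative. *)
Lemma esum_int_le a D : (forall n, 0 <= a n) ->
  (forall J : nat, a 0 + \sum_(1 <= m < 2 ^ J) (a m%:Z + a (- m%:Z)) <= D) ->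
  (\esum_(n in [set: int]) (a n)%:E <= D%:E)%E.
Proof.
move=> a0 aD; apply: ge_ereal_sup => _ [X [finX _] <-].
pose J := \max_(n <- finmap.enum_fset (fset_set X)) `|n|%N.
have XJ n : X n -> (`|n| <= J)%N.
  move=> Xn; apply: leq_bigmax_seq => //.
  by rewrite in_fset_set// inE.
pose M := (2 ^ J).-1.
have J2 : (0 < 2 ^ J)%N by rewrite expn_gt0.
have JM : (J <= M)%N by have := ltn_expl J (isT : 1 < 2)%N; rewrite /M; lia.
pose h (k : nat) : int := k%:Z - M%:Z.
have sub : {subset X <= [set h k | k in `I_(M.*2.+1)]}.
  move=> n; rewrite !inE => /XJ nJ; exists (absz (n + M%:Z)) => /=.
    by rewrite /mkset; lia.
  by rewrite /h; lia.
apply: (@le_trans _ _ (\sum_(n \in [set h k | k in `I_(M.*2.+1)]) (a n)%:E)%E).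
  apply: lee_fsum_nneg_subset => //.
  - exact/finite_image/finite_II.
  - by move=> n _; rewrite lee_fin.
rewrite fsbig_image; last by move=> i j _ _; rewrite /h; lia.
rewrite -(fsbig_ord _ _ (fun k => (a (h k))%:E)) sumEFin lee_fin.
rewrite (sum_symmetric a M); have := aD J.
by have -> : M.+1 = (2 ^ J)%N by rewrite /M; lia.
Qed.

Lemma dyadic_block_sum (V : zmodType) (F : nat -> V) J :
  \sum_(1 <= m < 2 ^ J) F m = \sum_(j < J) \sum_(2 ^ j <= m < 2 ^ j.+1) F m.
Proof.
elim: J => [|J IH]; first by rewrite expn0 big_geq// big_ord0.
rewrite big_ord_recr/= -IH (@big_cat_nat _ _ _ (2 ^ J))//= ?expn_gt0//.
by rewrite leq_exp2l.
Qed.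

(** On block j the Sobolev weight is at most 4^(s(j+1)), so the series compares with that of (4^s
    eta)^j; as eta < 1/2, some s > 1/2 keeps 4^s eta below 1. *)
Lemma sobolev_of_block_energy g (C eta : R) (j1 : nat) :
  0 <= C -> 0 < eta < 1 / 2 ->
  (forall j, (j1 <= j)%N -> block_energy g j <= C * eta ^+ j) ->
  sobolev_half_plus g.
Proof.
move=> C0 /andP[eta0 eta2] HB.
have ln4 : 0 < ln 4 :> R by rewrite ln_gt0// ltr1n.
(* The critical exponent, at which 4^s0 eta = 1; [s] is taken midway between 1/2 and [s0]. *)
pose s0 : R := - ln eta / ln 4.
have s0g : 1 / 2 < s0.
  rewrite /s0 ltr_pdivlMr// ltrNr.
  have -> : - (1 / 2 * ln 4) = ln (1 / 2) :> R.
    have -> : 4 = 2 ^+ 2 :> R by ring.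
    rewrite lnXn// div1r lnV ?posrE// [ln 2 *+ 2]mulr2n; lra.
  by rewrite ltr_ln ?posrE// divr_gt0.
pose s := (1 / 2 + s0) / 2.
exists s; first by rewrite /s; lra.
pose beta : R := 4 `^ s.
have beta0 : 0 < beta by rewrite powR_gt0.
have beta_eta : beta * eta < 1.
  rewrite -ltr_pdivlMr// div1r -ltr_ln ?posrE ?invr_gt0//.
  rewrite ln_powR lnV ?posrE// -ltr_pdivlMr//.
  by rewrite -/s0 /s; lra.
have bernstein (j k : nat) : (2 ^ j <= k < 2 ^ j.+1)%N ->
    (1 + k%:R ^+ 2) `^ s <= beta ^+ j.+1.
  move=> /andP[_ kj].
  have -> : beta ^+ j.+1 = (4 ^+ j.+1) `^ s.
    by rewrite -!powR_mulrn ?(ltW beta0)// /beta -!powRrM mulrC.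
  apply: ge0_ler_powR; rewrite ?nnegrE ?addr_ge0 ?sqr_ge0 ?exprn_ge0//.
    by rewrite /s; lra.
  have -> : 4 = 2 ^+ 2 :> R by ring.
  rewrite -exprM mulnC exprM.
  have : k%:R + 1 <= 2 ^+ j.+1 :> R by rewrite natr1 -natrX ler_nat.
  have := ler0n R k; move: k%:R (2 ^+ j.+1) => x y x0 xy.
  by rewrite !expr2; nra.
pose a (n : int) : R := (1 + n%:~R ^+ 2) `^ s * sqnorm (fourier g n).
have a0 n : 0 <= a n by rewrite mulr_ge0 ?powR_ge0 ?sqnorm_ge0.
pose W j := \sum_(2 ^ j <= m < 2 ^ j.+1) (a m%:Z + a (- m%:Z)).
have W0 j : 0 <= W j by apply: sumr_ge0 => m _; rewrite addr_ge0.
have Wle j : (j1 <= j)%N -> W j <= beta * C * (beta * eta) ^+ j.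
  move=> jj.
  apply: (@le_trans _ _ (beta ^+ j.+1 * block_energy g j)).
    rewrite /W /block_energy mulr_sumr !big_nat ler_sum// => m mj.
    rewrite mulrDr /a mulrNz sqrrN -pmulrn.
    by rewrite lerD// ler_wpM2r ?sqnorm_ge0// (bernstein j).
  rewrite (le_trans (ler_wpM2l _ (HB j jj)))// ?exprn_ge0 ?(ltW beta0)//.
  by rewrite exprS exprMn le_eqVlt; apply/orP; left; apply/eqP; ring.
have be0 : 0 < beta * eta by rewrite mulr_gt0.
pose D := a 0 + \sum_(j < j1) W j + beta * C / (1 - beta * eta).
apply: (@le_lt_trans _ _ D%:E); last exact: ltry.
apply: esum_int_le => // J; rewrite (dyadic_block_sum (fun m => a m%:Z + a (- m%:Z))).
rewrite /D -addrA lerD2l.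
(* The finitely many blocks below [j1] are kept as they are and go into the constant [D]. *)
apply: (@le_trans _ _ (\sum_(j < J) ((if (j < j1)%N then W j else 0) +
    beta * C * (beta * eta) ^+ j))).
  apply: ler_sum => j _; rewrite -/(W j); case: ltnP => [_|/Wle].
    by rewrite lerDl !mulr_ge0// ?exprn_ge0 ?(ltW beta0)// ltW.
  by rewrite add0r.
rewrite big_split/= lerD//.
  rewrite -big_mkcond/=.
  rewrite (big_ord_widen_cond (J + j1) (fun j => (j < j1)%N) W (leq_addr _ _)).
  rewrite (big_ord_widen (J + j1) W (leq_addl _ _)).
  rewrite big_mkcond [leRHS]big_mkcond ler_sum// => j _.
  by case: (j < j1)%N; case: (j < J)%N; rewrite /= ?lexx ?W0.
have := @geometric_le_lim R J (beta * C) (beta * eta).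
rewrite /series/= big_mkord; apply => //; first by rewrite mulr_ge0// ltW.
by rewrite gtr0_norm.
Qed.

End SobolevFromBlocks.

(** * Small dimension forces Sobolev regularity *)

Section DimensionOfEvolution.
Variable R : realType.
Variable g : R -> R[i].
Implicit Types (x e b rho : R) (u : R -> R[i]).

Lemma graph_coverable_ex (f : R -> R) e : 0 < e ->
  (forall eps, 0 < eps -> exists2 d, 0 < d &
    forall x h, `|h| <= d -> `|f (x + h) - f x| <= eps) ->
  exists n, coverable (graph_torus f) e n.
Proof.
move=> e0 /(_ 1 ltr01)[d d0 Hd].
pose w := Num.min d (e / 2).
have w0 : 0 < w by rewrite lt_min d0 divr_gt0.
have arch y : 0 < y -> y < (Num.bound (y / w))%:R * w.
  by move=> y0; rewrite -ltr_pdivrMr// archi_boundP// divr_ge0// ltW.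
exists (Num.bound (pi *+ 2 / w) * Num.bound ((1 : R) *+ 2 / w))%N.
apply: (@graph_coverable _ f w 1) => //.
- have : w <= e / 2 by rewrite ge_min lexx orbT.
  by rewrite [w *+ 2]mulr2n; lra.
- by apply: arch; rewrite mulrn_wgt0// pi_gt0.
- exact: arch.
- move=> x h /andP[h0 hw]; apply: Hd; rewrite ger0_norm// (le_trans hw)//.
  by rewrite ge_min lexx.
Qed.

Lemma ereal_lt_real_between (x : \bar R) (y : R) : (x < y%:E)%E ->
  exists2 b, b < y & (x < b%:E)%E.
Proof.
case: x => [r| |].
- by rewrite lte_fin => ry; exists ((r + y) / 2); rewrite ?lte_fin ?midf_lt.
- by [].
- by move=> _; exists (y - 1); [lra|exact: ltNyr].
Qed.

Lemma le_powR_of_ln_ratio (n : nat) e b : 0 < e < 1 ->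
  ln n%:R / ln (1 / e) <= b -> n%:R <= (1 / e) `^ b.
Proof.
move=> /andP[e0 e1].
have lne : 0 < ln (1 / e) by rewrite ln_gt0// div1r invf_gt1.
rewrite ler_pdivrMr// => le.
case: n le => [|n] le; first by rewrite powR_ge0.
by rewrite -ler_ln ?posrE ?ltr0n ?powR_gt0 ?div1r ?invr_gt0// -div1r ln_powR.
Qed.

Variable t : R.

(* Interpolating the first difference between its sup norm, controlled by the
   Hoelder exponent, and its L1 norm, controlled by the two covering numbers. *)
Lemma sobolev_of_small_dim u E rho b : 0 <= E -> 1 < rho < 2 ->
  uniform_evolution g t u ->
  (forall J x h, `|h| <= (2 ^+ J)^-1 ->
    normc (u (x + h) - u x) <= E * (rho / 2) ^+ J) ->
  0 <= b -> rho * 2 `^ b < 4 ->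
  (fractal_dim (graph_torus (fun x => complex.Re (u x))) < b%:E)%E ->
  (fractal_dim (graph_torus (fun x => complex.Im (u x))) < b%:E)%E ->
  sobolev_half_plus g.
Proof.
move=> E0 /andP[rho1 rho2] ue uH b0 rb dR dI.
have rho0 : 0 < rho by rewrite (lt_trans _ rho1).
have rho02 : 0 < rho < 2 by rewrite rho0.
have um := holder_modulus E0 rho02 uH.
have umRe eps : 0 < eps -> exists2 d, 0 < d &
    forall x h, `|h| <= d -> `|complex.Re (u (x + h)) - complex.Re (u x)| <= eps.
  move=> /um[d d0 Hd]; exists d => // x h hd.
  by rewrite -ReB (le_trans (normr_Re_le _))// Hd.
have umIm eps : 0 < eps -> exists2 d, 0 < d &
    forall x h, `|h| <= d -> `|complex.Im (u (x + h)) - complex.Im (u x)| <= eps.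
  move=> /um[d d0 Hd]; exists d => // x h hd.
  by rewrite -ImB (le_trans (normr_Im_le _))// Hd.
have [eR eR0 HR] := limf_esup_right_lt dR.
have [eI eI0 HI] := limf_esup_right_lt dI.
pose gam : R := 2 `^ b.
have gam0 : 0 < gam by rewrite powR_gt0.
(* The energy bound has the form A e N / 2^j with A of rate rho/2, e of rate 1/2 and the covering
   numbers N of rate [gam]; the product of the rates is rho gam / 8, below 1/2 exactly when rho gam
   < 4. *)
pose eta := rho * gam / 8.
have eta0 : 0 < eta by rewrite divr_gt0// mulr_gt0.
have eta2 : eta < 1 / 2 by rewrite /eta /gam; lra.
have eta02 : 0 < eta < 1 / 2 by rewrite eta0.
(* Halved so that e <= e1 yields strict inequalities. *)
pose e1 := Num.min (Num.min eR eI) 1 / 2.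
have e10 : 0 < e1 by rewrite divr_gt0// !lt_min eR0 eI0 ltr01.
have pi0 := @pi_gt0 R.
have h01 : 0 < (2^-1 : R) < 1 by rewrite invr_gt0 ltr0n invf_lt1// ltr1n.
have [j1 Hj1] := exp_small h01 (ltW pi0) e10.
apply: (@sobolev_of_block_energy R g (E * gam ^+ 3 / eta) eta j1.+1) => //.
  by rewrite divr_ge0 ?mulr_ge0 ?exprn_ge0// ltW.
(* Block i + 1 is paired with the Hoelder estimate at scale i, because its step w = 2 pi / 2^(i+3)
   is at most 8 / 2^(i+3) = 2^-i. *)
case=> // i ij; have {}ij : (j1 <= i)%N by [].
have p2 (n : nat) : 0 < 2 ^+ n :> R by rewrite exprn_gt0.
(* Half of [w], the largest radius for which a ball is shared by at most two columns. *)
pose e : R := pi / 2 ^+ i.+3.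
pose w : R := pi *+ 2 / (2 ^ i.+3)%:R.
have wE : w = 2 * e by rewrite /w /e natrX mulr2n; ring.
have e0 : 0 < e by rewrite divr_gt0.
have ee1 : e <= e1.
  rewrite (le_trans _ (Hj1 i.+3 _))//; first by rewrite /e exprVn.
  by rewrite (leq_trans ij)// -addn3 leq_addr.
have [eRl eIl el] : [/\ e < eR, e < eI & e < 1].
  have : Num.min (Num.min eR eI) 1 <= eR by rewrite !ge_min lexx.
  have : Num.min (Num.min eR eI) 1 <= eI by rewrite !ge_min lexx orbT.
  have : Num.min (Num.min eR eI) 1 <= 1 by rewrite ge_min lexx orbT.
  by move: ee1 e10; rewrite /e1 => *; split; lra.
have e_lt1 : 0 < e < 1 by rewrite e0.
have le_gam (n : nat) : n%:R <= (1 / e) `^ b -> n%:R <= gam ^+ i.+3.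
  move=> /le_trans; apply.
  have -> : gam ^+ i.+3 = (2 ^+ i.+3) `^ b.
    by rewrite -!powR_mulrn ?(ltW gam0)// /gam -!powRrM mulrC.
  have ile : 1 / e <= 2 ^+ i.+3.
    rewrite /e div1r invf_div ler_pdivrMr// ler_peMr ?(ltW (p2 _))//.
    by rewrite (le_trans _ (pi_ge2 R))// ler1n.
  have i0 : 0 <= 1 / e by rewrite divr_ge0// ltW.
  by apply: ge0_ler_powR; rewrite ?nnegrE ?(ltW (p2 _)).
have [nR' cR'] := graph_coverable_ex e0 umRe.
have [nI' cI'] := graph_coverable_ex e0 umIm.
have [cR _] := covering_numberP cR'; have [cI _] := covering_numberP cI'.
have NR : (covering_number (graph_torus (fun x => complex.Re (u x))) e)%:R <= gam ^+ i.+3.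
  by apply/le_gam/le_powR_of_ln_ratio => //; apply: HR; rewrite e0.
have NI : (covering_number (graph_torus (fun x => complex.Im (u x))) e)%:R <= gam ^+ i.+3.
  by apply/le_gam/le_powR_of_ln_ratio => //; apply: HI; rewrite e0.
have e4 : e <= 4 / 2 ^+ i.+3.
  by rewrite ler_pM2r ?invr_gt0//; have := @pihalf_lt2 R; lra.
have wi : `|w| <= (2 ^+ i)^-1.
  rewrite wE gtr0_norm ?mulr_gt0//; apply: (@le_trans _ _ (2 * (4 / 2 ^+ i.+3))).
    by rewrite ler_pM2l.
  by rewrite le_eqVlt; apply/orP; left; apply/eqP; rewrite !exprS; field; rewrite gt_eqF.
have A0 : 0 <= E * (rho / 2) ^+ i by rewrite mulr_ge0// exprn_ge0// divr_ge0// ltW.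
have := block_energy_bound ue um (erefl w) e0 _ (fun x => uH i x w wi) cR cI.
rewrite wE lexx => /(_ isT) /le_trans; apply.
set nR := covering_number _ _ in NR *; set nI := covering_number _ _ in NI *.
apply: (@le_trans _ _ (8 * (E * (rho / 2) ^+ i) * (4 / 2 ^+ i.+3) *
   (gam ^+ i.+3 + gam ^+ i.+3) / 2 ^+ i.+3)).
  rewrite natrX ler_pM2r ?invr_gt0// natrD.
  have h1 : 8 * (E * (rho / 2) ^+ i) * e <= 8 * (E * (rho / 2) ^+ i) * (4 / 2 ^+ i.+3).
    by rewrite ler_wpM2l// mulr_ge0.
  have h0 : 0 <= 8 * (E * (rho / 2) ^+ i) * e.
    by rewrite mulr_ge0 ?(ltW e0)// mulr_ge0.
  by rewrite ler_pM// lerD.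
rewrite le_eqVlt; apply/orP; left; apply/eqP.
rewrite /eta !exprS !expr_div_n !exprMn.
have -> : 8 ^+ i = 2 ^+ i * 2 ^+ i * 2 ^+ i :> R.
  by rewrite -!exprMn; congr (_ ^+ _); ring.
field; rewrite !gt_eqF// ?exprn_gt0//.
Qed.

End DimensionOfEvolution.

Theorem mainTheorem15 (R : realType) (g : R -> R[i])
    (hBV : BV_torus g) (hH : ~ sobolev_half_plus g) :
  {ae @lebesgue_measure R, forall t : R,
    evolution_dim (@boussinesq R) g t (3 / 2)%:E}.
Proof.
have ln2 : 0 < ln 2 :> R by rewrite ln_gt0// ltr1n.
(* Starting at 1/3 keeps 1/2 + ep p below 1, hence rho p < 2. *)
pose ep (p : nat) : R := p.+3%:R^-1.
have ep0 p : 0 < ep p by rewrite invr_gt0.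
have ep3 p : ep p <= 3^-1 by rewrite lef_pV2 ?posrE// ler_nat.
pose rho (p : nat) : R := 2 `^ (1 / 2 + ep p).
have rho0 p : 0 < rho p by rewrite powR_gt0.
have rhoE p : ln (rho p) = (1 / 2 + ep p) * ln 2 by rewrite ln_powR.
have rho12 p : 1 < rho p < 2.
  apply/andP; split.
    by rewrite -ltr_ln ?posrE// rhoE ln1 mulr_gt0//; have := ep0 p; lra.
  by rewrite -ltr_ln ?posrE// rhoE gtr_pMl//; have := ep3 p; lra.
have rhosq p : 2 < rho p ^+ 2.
  rewrite -ltr_ln ?posrE ?exprn_gt0// lnXn// rhoE.
  have : 0 < ep p * ln 2 by rewrite mulr_gt0.
  by rewrite [(_ * ln 2) *+ 2]mulr2n; lra.
(* The rates are countably many, so one null set serves them all. *)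
have := ae_foralln (fun p => ae_weyl_bound (rho0 p) (rhosq p)).
apply: ae_lebesgue_imply => t wb.
have [C0 C00 wb0] := wb 0%N.
have [u [E0 [_ ue _]]] := uniform_evolution_holder hBV C00 (rho12 0%N) wb0.
have holder p : exists2 E : R, 0 <= E & forall J x h, `|h| <= (2 ^+ J)^-1 ->
    normc (u (x + h) - u x) <= E * (rho p / 2) ^+ J.
  have [C Cge0 wbp] := wb p.
  have [v [E [Ege0 ve vH]]] := uniform_evolution_holder hBV Cge0 (rho12 p) wbp.
  (* The limit [v] found at rate rho p is the [u] found at rate rho 0. *)
  by exists E => //; rewrite (uniform_evolution_unique ue ve).
exists u.
  apply: uniform_evolution_continuous ue.
  have [E Ege0 uH] := holder 0%N.
  by apply: holder_modulus Ege0 _ uH; rewrite rho0; case/andP: (rho12 0%N).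
have le_dim (f : R -> R) : (forall p, exists2 E : R, 0 <= E &
      forall J x h, `|h| <= (2 ^+ J)^-1 -> `|f (x + h) - f x| <= E * (rho p / 2) ^+ J) ->
    (fractal_dim (graph_torus f) <= (3 / 2)%:E)%E.
  move=> fH; apply/lee_addgt0Pr => eta eta0.
  pose p := Num.bound eta^-1.
  have [E Ege0 Hf] := fH p.
  rewrite (le_trans (fractal_dim_graph_le Ege0 (rho12 p) Hf))// -EFinD lee_fin.
  (* The bound 1 + ln (rho p) / ln 2 is 3/2 + ep p. *)
  rewrite rhoE mulfK ?gt_eqF//.
  have : ep p <= eta.
    rewrite invf_ple ?posrE// (le_trans (ltW (archi_boundP _)))//.
      by rewrite invr_ge0 ltW.
    by rewrite ler_nat (leq_trans (leqnSn _))// (leq_trans (leqnSn _)).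
  lra.
apply/le_anti/andP; split.
  rewrite /max_graph_dim ge_max; apply/andP; split; apply: le_dim => p.
    have [E Ege0 uH] := holder p; exists E => // J x h hJ.
    by rewrite -ReB (le_trans (normr_Re_le _))// uH.
  have [E Ege0 uH] := holder p; exists E => // J x h hJ.
  by rewrite -ImB (le_trans (normr_Im_le _))// uH.
(* Were the maximum below 3/2, both dimensions would lie below some b < 3/2, and [g] would belong to
   some H^s with s > 1/2. *)
rewrite leNgt; apply/negP; rewrite /max_graph_dim gt_max => /andP[].
move=> /ereal_lt_real_between[b1 b1lt d1] /ereal_lt_real_between[b2 b2lt d2].
apply: hH.
pose b := Num.max 1 (Num.max b1 b2).
have b1b : b1 <= b by rewrite !le_max lexx orbT.
have b2b : b2 <= b by rewrite !le_max lexx !orbT.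
have b_ge1 : 1 <= b by rewrite le_max lexx.
have b_lt : b < 3 / 2 by rewrite !gt_max b1lt b2lt andbT; lra.
have d0 : 0 < 3 / 2 - b by rewrite subr_gt0.
(* The product of rho p and 2^b is 2^(1/2 + ep p + b), below 4 once ep p < 3/2 - b. *)
pose p := Num.bound (3 / 2 - b)^-1.
have epb : ep p < 3 / 2 - b.
  rewrite invf_plt ?posrE//; apply: lt_le_trans (archi_boundP _) _.
    by rewrite invr_ge0 ltW.
  by rewrite ler_nat (leq_trans (leqnSn _))// (leq_trans (leqnSn _)).
have [E Ege0 uH] := holder p.
apply: (@sobolev_of_small_dim R g t u E (rho p) b) => //.
- by rewrite (le_trans _ b_ge1).
- rewrite /rho -powRD; last by rewrite pnatr_eq0 implybT.
  have -> : 4 = 2 `^ 2 :> R by rewrite powR_mulrn//; ring.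
  by rewrite -ltr_ln ?posrE ?powR_gt0// !ln_powR ltr_pM2r//; lra.
- by rewrite (lt_le_trans d1)// lee_fin.
- by rewrite (lt_le_trans d2)// lee_fin.
Qed.
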